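(* Let $U$ and $V$ be two unitary operators on a Hilbert space $\mathcal{H}$ with spectral measures $E$ and $F$ respectively. Suppose $U-V\in\mathcal{S}_2(\mathcal{H})$. Then $$f(U)-f(V)=\int_0^{2\pi}\int_0^{2\pi}\frac{f(e^{i\lambda})-f(e^{i\mu})}{e^{i\lambda}-e^{i\mu}}\,dE(\lambda)\,(U-V)\,dF(\mu)$$ for any Lipschitz function $f:\mathbb{T}\to\mathbb{C}$. Furthermore, $$\|f(U)-f(V)\|_2\le\|f\|_{\mathrm{Lip}(\mathbb{T})}\,\|U-V\|_2 .$$
   Context: $\mathbb{T}$ is the unit circle; $\mathcal{S}_2(\mathcal{H})$ is the Hilbert-Schmidt class with norm $\|\cdot\|_2$; $\|f\|_{\mathrm{Lip}(\mathbb{T})}=\sup\{|f(z)-f(w)|/|z-w|: z,w\in\mathbb{T},\ z\ne w\}$. The spectral measures $E,F$ are regarded as projection-valued Borel measures on $[0,2\pi]$ with $U=\int_0^{2\pi}e^{i\lambda}\,dE(\lambda)$ and $V=\int_0^{2\pi}e^{i\mu}\,dF(\mu)$. Double operator integral (Birman–Solomyak): let $G$ be the spectral measure on the Borel sets of $[0,2\pi]\times[0,2\pi]$, acting on the Hilbert space $\mathcal{S}_2(\mathcal{H})$, determined by $G(\delta\times\sigma)(X)=E(\delta)XF(\sigma)$ for Borel $\delta,\sigma\subseteq[0,2\pi]$ and $X\in\mathcal{S}_2(\mathcal{H})$. For $\Phi\in L^\infty([0,2\pi]\times[0,2\pi],G)$ and $X\in\mathcal{S}_2(\mathcal{H})$,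 $$\int_0^{2\pi}\int_0^{2\pi}\Phi(\lambda,\mu)\,dE(\lambda)\,X\,dF(\mu):=\left(\int_0^{2\pi}\int_0^{2\pi}\Phi(\lambda,\mu)\,dG(\lambda,\mu)\right)(X).$$ The difference quotient $\frac{f(e^{i\lambda})-f(e^{i\mu})}{e^{i\lambda}-e^{i\mu}}$ is taken to be $0$ where $e^{i\lambda}=e^{i\mu}$. *)

(* Defs.v *)
From HB Require Import structures.
From mathcomp Require Import all_boot all_order all_algebra.
From mathcomp Require Import complex.
From mathcomp Require Import all_classical all_reals all_analysis.

Set Implicit Arguments.
Unset Strict Implicit.
Unset Printing Implicit Defensive.
Import Order.TTheory GRing.Theory Num.Theory.
Import numFieldNormedType.Exports.

Local Open Scope classical_set_scope.
Local Open Scope ring_scope.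
Local Open Scope complex_scope.

(* Inner products are linear in the first variable (as the library's {dot})
   and norms take their values in R[i]; complex.Re is used to come back to R. *)

Section Polarization.
Context {R : realType} {V : lmodType R[i]}.

(* The sesquilinear form (linear in the first variable) with diagonal q. *)
Definition polarize (q : V -> R[i]) (x y : V) : R[i] :=
  4^-1 * \sum_(k < 4) (0 +i* 1) ^+ k * q (x + (0 +i* 1) ^+ k *: y).

End Polarization.

(* Projection-valued measures on the measurable subsets of D, acting on a
   subspace K of V which is a Hilbert space for ip. The ambient V is there so
   that the same notion applies to H (K = setT) and to the Hilbert-Schmidt
   class (V = H -> H). *)
Section SpectralMeasure.
Context {R : realType} {V : lmodType R[i]} (K : set V) (ip : V -> V -> R[i]).
Context {d : measure_display} {T : measurableType d} (D : set T).

Record spectral_measure (P : set T -> V -> V) : Prop := SpectralMeasure {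
  spectral_stable : forall A, measurable A -> A `<=` D ->
    forall x, K x -> K (P A x) ;
  spectral_linear : forall A, measurable A -> A `<=` D ->
    forall a x y, K x -> K y -> P A (a *: x + y) = a *: P A x + P A y ;
  spectral_idempotent : forall A, measurable A -> A `<=` D ->
    forall x, K x -> P A (P A x) = P A x ;
  spectral_selfadjoint : forall A, measurable A -> A `<=` D ->
    forall x y, K x -> K y -> ip (P A x) y = ip x (P A y) ;
  spectral_total : forall x, K x -> P D x = x ;
  (* countable additivity in the strong operator topology *)
  spectral_sigma_additive : forall F : (set T)^nat,
    (forall n, measurable (F n)) -> (forall n, F n `<=` D) ->
    trivIset [set: nat] F -> forall x, K x ->
    let r n := P (\bigcup_k F k) x - \sum_(k < n) P (F k) x in
    (fun n => complex.Re (ip (r n) (r n))) @ \oo --> (0 : R) }.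

(* A |-> <P(A) x, x>, as a measure on T carried by D *)
Definition scalar_measure (P : set T -> V -> V) (x : V) (A : set T) : \bar R :=
  (complex.Re (ip (P (A `&` D) x) x))%:E.

Definition complex_integral (mu : set T -> \bar R) (Phi : T -> R[i]) : R[i] :=
  fine (\int[mu]_(t in D) (complex.Re (Phi t))%:E)%E +i*
  fine (\int[mu]_(t in D) (complex.Im (Phi t))%:E)%E.

(* (\int_D Phi dP) x is the vector z of K such that
   <z, y> = \int_D Phi(t) d<P(t) x, y> for all y in K, the integral with
   respect to the complex measure <P(.) x, y> being given by polarization. *)
Definition spectral_integral (P : set T -> V -> V) (Phi : T -> R[i]) (x : V) : V :=
  xget 0 [set z | K z /\ forall y, K y ->
    ip z y = polarize (fun v => complex_integral (scalar_measure P v) Phi) x y].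

End SpectralMeasure.

Section HilbertSchmidt.
Context {R : realType} {H : completeNormedModType R[i]}.
Variable dot : {dot H for @Num.conj R[i]}.

Definition orthonormal_set (B : set H) : Prop :=
  (forall e, B e -> dot e e = 1) /\
  (forall e e', B e -> B e' -> e != e' -> dot e e' = 0).

Definition orthonormal_basis (B : set H) : Prop :=
  orthonormal_set B /\ (forall x, (forall e, B e -> dot x e = 0) -> x = 0).

Lemma exists_orthonormal_basis : exists B, orthonormal_basis B.
Proof.
have := @Zorn_bigcup H orthonormal_set; case.
  move=> F FO Ftot; split=> [e [A FA Ae]|e e' [A FA Ae] [A' FA' Ae'] ee'].
    by have [A1 _] := FO _ FA; exact: A1.
  have [AA'|A'A] := Ftot _ _ FA FA'.
    by have [_ AO] := FO _ FA'; apply: AO => //; exact: AA'.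
  by have [_ AO] := FO _ FA; apply: AO => //; exact: A'A.
move=> B [[B1 BO] Bmax]; exists B; split=> // x xB; apply/eqP/negP => /negP x0.
have xx : 0 < dot x x by rewrite dnorm_gt0.
pose c : R[i] := (sqrtC (dot x x))^-1.
have c0 : 0 < c by rewrite invr_gt0 sqrtC_gt0.
pose u := c *: x.
have uB e : B e -> dot u e = 0 by move=> Be; rewrite linearZl_LR /= xB // mulr0.
have Bu e : B e -> dot e u = 0.
  by move=> Be; rewrite hermC /= uB // rmorph0 mulr0.
have u1 : dot u u = 1.
  by rewrite dnormZ ger0_norm ?ltW// exprVn sqrtCK mulVf// gt_eqF.
apply: (Bmax (B `|` [set u])).
  split=> [|BuB]; first by move=> y By; left.
  by have := uB _ (BuB u (or_intror erefl)); rewrite u1 => /eqP; rewrite oner_eq0.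
split=> [e [/B1//|->//]|e e' [Be|->] [Be'|->] ee'].
- exact: BO.
- exact: Bu.
- exact: uB.
- by rewrite eqxx in ee'.
Qed.

(* A fixed orthonormal basis; the notions below do not depend on it. *)
Definition onb : set H := sval (cid exists_orthonormal_basis).

Definition hs_norm (X : H -> H) : \bar R :=
  sqrte (\esum_(e in onb) (complex.Re (dot (X e) (X e)))%:E).

(* Boundedness has to be required: an unbounded operator may vanish on a basis. *)
Definition hilbert_schmidt : set (H -> H) :=
  [set X | [/\ linear X, continuous X & (hs_norm X < +oo)%E]].

Definition hs_dot : (H -> H) -> (H -> H) -> R[i] :=
  polarize (fun X => (fine (hs_norm X) ^+ 2)%:C).

End HilbertSchmidt.

Section DoubleOperatorIntegral.
Context {R : realType} {H : completeNormedModType R[i]}.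
Variable dot : {dot H for @Num.conj R[i]}.

Definition unitary (U : H -> H) : Prop :=
  [/\ linear U, forall x y, dot (U x) (U y) = dot x y
    & forall y, exists x, U x = y].

Definition segment : set R := `[0, 2 * pi].

Definition expi (t : R) : R[i] := cos t +i* sin t.

Definition operator_integral (E : set R -> H -> H) (phi : R -> R[i]) : H -> H :=
  spectral_integral [set: H] dot segment E phi.

Definition spectral_measure_of (U : H -> H) (E : set R -> H -> H) : Prop :=
  spectral_measure [set: H] dot segment E /\ U = operator_integral E expi.

(* f(U), for U with spectral measure E *)
Definition functional_calculus (f : R[i] -> R[i]) (E : set R -> H -> H) : H -> H :=
  operator_integral E (f \o expi).

Definition double_spectral_measure (E F : set R -> H -> H)
    (G : set (R * R) -> (H -> H) -> (H -> H)) : Prop :=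
  spectral_measure (hilbert_schmidt dot) (hs_dot dot) (segment `*` segment) G /\
  forall A B, measurable A -> A `<=` segment -> measurable B -> B `<=` segment ->
    forall X, hilbert_schmidt dot X -> G (A `*` B) X = E A \o X \o F B.

Definition double_operator_integral (G : set (R * R) -> (H -> H) -> (H -> H))
    (Phi : R * R -> R[i]) (X : H -> H) : H -> H :=
  spectral_integral (hilbert_schmidt dot) (hs_dot dot) (segment `*` segment)
    G Phi X.

End DoubleOperatorIntegral.

Section Lipschitz.
Context {R : realType}.

(* A function on the circle is represented by any extension to R[i]; only the
   values on the circle are used. *)
Definition lip_norm (f : R[i] -> R[i]) : \bar R :=
  ereal_sup [set r | exists z w, [/\ `|z| = 1, `|w| = 1, z != w
    & r = (complex.Re (`|f z - f w| / `|z - w|))%:E]].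

Definition lipschitz_circle (f : R[i] -> R[i]) : Prop := (lip_norm f < +oo)%E.

Definition difference_quotient (f : R[i] -> R[i]) (p : R * R) : R[i] :=
  if expi p.1 == expi p.2 then 0
  else (f (expi p.1) - f (expi p.2)) / (expi p.1 - expi p.2).

End Lipschitz.

(* Main.v *)
Require Import Defs.
From HB Require Import structures.
From mathcomp Require Import all_boot all_order all_algebra.
From mathcomp Require Import complex.
From mathcomp Require Import all_classical all_reals all_analysis.
From mathcomp Require Import finmap measurable_realfun ring lra.

(** Write X = U - V and W = f(U) - f(V). If E and F are cut along a partition of
    the circle into small arcs with nodes z_j, and P_j, Q_k are the values of E
    and F on the arcs, then up to small errors U P_j = z_j P_j and
    Q_k V = z_k Q_k. Hence P_j X Q_k is close to (z_j - z_k) P_j Q_k and P_j W Q_k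
    is close to (f(z_j) - f(z_k)) P_j Q_k, so that a block of W is the block of X
    times the difference quotient, which is at most the Lipschitz constant.
    Distinct blocks are orthogonal in the Hilbert-Schmidt class
    ([hs_le_blocks]), which sums the blockwise statements into the norm estimate
    and into the integral formula.

    The errors are relative to |z_j - z_k|, and the products P_j Q_k need not be
    Hilbert-Schmidt when the arcs are close. Blocks with |z_j - z_k| < eta are
    therefore separated from the others.
    - For far blocks, P_j X Q_k = (z_j - z_k) T + A T - T C with T = P_j Q_k and A,
      C of norm at most delta, a bound for the width of the arcs. This Sylvester equation
      shows that T is Hilbert-Schmidt, and that the error is of relative size
      delta / eta ([sylvester_bound], [far_difference_le]).
    - The near blocks are small in operator norm only: a crude count gives
      L eta sqrt(n) for n arcs ([near_difference_le]).
    With delta and 1 / n of order h^3 and eta = h^2 both errors vanish as h tends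
    to 0. The far part of W then converges to W in operator norm while its
    Hilbert-Schmidt norm is at most L (1 + h) times that of X; lower
    semicontinuity ([hs_le_lim]) gives the norm inequality.

    For the formula, the far part is compared with the sum of the quotients times
    P_j X Q_k, which is the integral against G of a step function. These step
    functions converge pointwise and boundedly to the difference quotient, with
    the value 0 on the diagonal, so dominated convergence identifies their weak
    limit as the double operator integral ([spectral_integral_step]). The same
    limit is W, because bounded sequences of the class that converge in operator
    norm converge weakly ([hs_dot_weak]). *)

Set Implicit Arguments.
Unset Strict Implicit.
Unset Printing Implicit Defensive.
Import Order.TTheory GRing.Theory Num.Theory.
Import numFieldNormedType.Exports.
Import Normc.

Local Open Scope classical_set_scope.
Local Open Scope ring_scope.
Local Open Scope complex_scope.

(** * Complex numbers and their limits *)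

Section ComplexNumbers.
Context {R : realType}.
Implicit Types (a b z w : R[i]).

Lemma normr_normc z : `|z| = (normc z)%:C.
Proof. by []. Qed.

Lemma normc_ge0 z : 0 <= normc z.
Proof. by case: z => x y; exact: sqrtr_ge0. Qed.

Lemma normcB_sym z w : normc (z - w) = normc (w - z).
Proof. by rewrite -opprB normcN. Qed.

Lemma normc_conj z : normc (conjc z) = normc z.
Proof. by case: z => x y /=; rewrite sqrrN. Qed.

Lemma Re_le_normc z : `|complex.Re z| <= normc z.
Proof.
case: z => x y /=; rewrite -sqrtr_sqr ler_sqrt ?addr_ge0 ?sqr_ge0//.
by rewrite lerDl sqr_ge0.
Qed.

Lemma Im_le_normc z : `|complex.Im z| <= normc z.
Proof.
case: z => x y /=; rewrite -sqrtr_sqr ler_sqrt ?addr_ge0 ?sqr_ge0//.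
by rewrite lerDr sqr_ge0.
Qed.

Lemma normc_le_ReIm z : normc z <= `|complex.Re z| + `|complex.Im z|.
Proof.
case: z => x y /=.
rewrite -[leRHS]ger0_norm ?addr_ge0// -[leRHS]sqrtr_sqr ler_sqrt ?sqr_ge0//.
rewrite sqrrD !real_normK ?num_real// -addrA lerD2l lerDr.
by rewrite mulrn_wge0// mulr_ge0.
Qed.

Lemma normc_sqr z : normc z ^+ 2 = complex.Re (z * (conjc z)).
Proof.
case: z => x y /=; rewrite sqr_sqrtr ?addr_ge0 ?sqr_ge0//.
by rewrite mulrN opprK !expr2.
Qed.

Lemma ReD z w : complex.Re (z + w) = complex.Re z + complex.Re w.
Proof. by case: z w => [? ?] []. Qed.

Lemma ImD z w : complex.Im (z + w) = complex.Im z + complex.Im w.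
Proof. by case: z w => [? ?] []. Qed.

Lemma ReB z w : complex.Re (z - w) = complex.Re z - complex.Re w.
Proof. by case: z w => [? ?] []. Qed.

Lemma ImB z w : complex.Im (z - w) = complex.Im z - complex.Im w.
Proof. by case: z w => [? ?] []. Qed.

Lemma ReM z w : complex.Re (z * w) =
  complex.Re z * complex.Re w - complex.Im z * complex.Im w.
Proof. by case: z w => [? ?] []. Qed.

Lemma ImM z w : complex.Im (z * w) =
  complex.Re z * complex.Im w + complex.Im z * complex.Re w.
Proof. by case: z w => [? ?] []. Qed.

Lemma ReJ z : complex.Re (conjc z) = complex.Re z.
Proof. by case: z. Qed.

Lemma ImJ z : complex.Im (conjc z) = - complex.Im z.
Proof. by case: z. Qed.

Lemma Re_sum I (r : seq I) (P : pred I) (F : I -> R[i]) :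
  complex.Re (\sum_(i <- r | P i) F i) = \sum_(i <- r | P i) complex.Re (F i).
Proof. by apply: (big_morph _ ReD). Qed.

Lemma Im_sum I (r : seq I) (P : pred I) (F : I -> R[i]) :
  complex.Im (\sum_(i <- r | P i) F i) = \sum_(i <- r | P i) complex.Im (F i).
Proof. by apply: (big_morph _ ImD). Qed.

Lemma complex_eq z w : complex.Re z = complex.Re w ->
  complex.Im z = complex.Im w -> z = w.
Proof. by case: z w => [? ?] [? ?] /= -> ->. Qed.

(** Convergence in the plane, coordinate by coordinate: the real and imaginary
    parts are what integrals and sums of squares produce. *)
Definition cvgC {I : Type} (F : set_system I) (a : I -> R[i]) (l : R[i]) :=
  (complex.Re (a i) @[i --> F] --> complex.Re l) /\
  (complex.Im (a i) @[i --> F] --> complex.Im l).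

Section CvgC.
Context {I : Type} {F : set_system I} {FF : ProperFilter F}.
Implicit Types (u v : I -> R[i]).

Lemma eq_cvgC u v l : u =1 v -> cvgC F u l -> cvgC F v l.
Proof. by move=> /funext ->. Qed.

Lemma cvgC_cst l : cvgC F (fun=> l) l.
Proof. by split; exact: cvg_cst. Qed.

Lemma cvgCD u v l m : cvgC F u l -> cvgC F v m -> cvgC F (fun i => u i + v i) (l + m).
Proof.
move=> [ul ul'] [vm vm']; split.
  by under eq_fun do rewrite ReD; rewrite ReD; exact: cvgD.
by under eq_fun do rewrite ImD; rewrite ImD; exact: cvgD.
Qed.

Lemma cvgCM c u l : cvgC F u l -> cvgC F (fun i => c * u i) (c * l).
Proof.
move=> [ul ul']; split.
  under eq_fun do rewrite ReM; rewrite ReM.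
  by apply: cvgB; apply: cvgM => //; exact: cvg_cst.
under eq_fun do rewrite ImM; rewrite ImM.
by apply: cvgD; apply: cvgM => //; exact: cvg_cst.
Qed.

Lemma cvgC_conj u l : cvgC F u l -> cvgC F (fun i => conjc (u i)) (conjc l).
Proof.
move=> [ul ul']; split.
  by rewrite ReJ; under eq_fun do rewrite ReJ.
by rewrite ImJ; under eq_fun do rewrite ImJ; exact: cvgN.
Qed.

Lemma cvgC_sum J (r : seq J) (P : pred J) (u : J -> I -> R[i]) (l : J -> R[i]) :
  (forall j, cvgC F (u j) (l j)) ->
  cvgC F (fun i => \sum_(j <- r | P j) u j i) (\sum_(j <- r | P j) l j).
Proof.
move=> ul; elim: r => [|j r IH].
  by rewrite big_nil; under eq_fun do rewrite big_nil; exact: cvgC_cst.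
rewrite big_cons; under eq_fun do rewrite big_cons.
by case: (P j) => //; exact: cvgCD.
Qed.

Lemma cvgC_unique u l m : cvgC F u l -> cvgC F u m -> l = m.
Proof.
move=> [ul ul'] [um um']; apply: complex_eq.
  exact: (@cvg_unique _ (@norm_hausdorff _ _) _ _ _ _ ul um).
exact: (@cvg_unique _ (@norm_hausdorff _ _) _ _ _ _ ul' um').
Qed.

Lemma cvgr_squeeze (f : I -> R) (a : R) (b : I -> R) :
  (\forall i \near F, `|f i - a| <= b i) -> b i @[i --> F] --> 0 ->
  f i @[i --> F] --> a.
Proof.
move=> fb b0; apply/subr_cvg0.
apply: (squeeze_cvgr (f := fun i => - b i) (h := b)) => //.
  by apply: filterS fb => i; rewrite ler_norml.
by rewrite -oppr0; exact: cvgN.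
Qed.

Lemma cvgC_squeeze u l (b : I -> R) :
  (\forall i \near F, normc (u i - l) <= b i) ->
  b i @[i --> F] --> 0 -> cvgC F u l.
Proof.
move=> ub b0; split; apply: (cvgr_squeeze _ b0); apply: filterS ub => i.
  by apply: le_trans; rewrite -ReB; exact: Re_le_normc.
by apply: le_trans; rewrite -ImB; exact: Im_le_normc.
Qed.

Lemma cvgC0_eps u :
  (forall eps : R, 0 < eps -> \forall i \near F, normc (u i) <= eps) ->
  cvgC F u 0.
Proof.
move=> ueps; split; apply/cvgrPdist_le => eps eps0;
  apply: filterS (ueps _ eps0) => n; apply: le_trans; rewrite /= sub0r normrN.
  exact: Re_le_normc.
exact: Im_le_normc.
Qed.

Lemma cvgC_normc u l : cvgC F u l -> normc (u i) @[i --> F] --> normc l.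
Proof.
move=> [ul ul'].
have h z : normc z = Num.sqrt (complex.Re z ^+ 2 + complex.Im z ^+ 2) by case: z.
rewrite h; under eq_fun do rewrite h.
apply: continuous_cvg; first exact: sqrt_continuous.
by apply: cvgD; rewrite expr2; under eq_fun do rewrite expr2; exact: cvgM.
Qed.

End CvgC.
End ComplexNumbers.

(** * Inner products and spectral measures *)

Section InnerProducts.
Context {R : realType} {V : lmodType R[i]}.

(** The axioms common to H and to the Hilbert-Schmidt class, the latter being
    only a subspace of the ambient space of all maps. *)
Record inner_product (K : set V) (ip : V -> V -> R[i]) : Prop := InnerProduct {
  ip_sub0 : K 0 ;
  ip_sub : forall a x y, K x -> K y -> K (a *: x + y) ;
  ip_linear : forall a x y z, K x -> K y -> K z ->
    ip (a *: x + y) z = a * ip x z + ip y z ;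
  ip_herm : forall x y, K x -> K y -> ip y x = conjc (ip x y) ;
  ip_ge0 : forall x, K x -> 0 <= ip x x ;
  ip_definite : forall x, K x -> ip x x = 0 -> x = 0 }.

(** Weak integrals and the inner product of the Hilbert-Schmidt class are both
    defined by polarizing a diagonal; this recovers the form from it. *)
Lemma polarize_sesquilinear (K : set V) (B : V -> V -> R[i]) x y :
  (forall a x y, K x -> K y -> K (a *: x + y)) ->
  (forall a x y z, K x -> K y -> K z -> B (a *: x + y) z = a * B x z + B y z) ->
  (forall a x y z, K x -> K y -> K z -> B z (a *: x + y) = conjc a * B z x + B z y) ->
  K x -> K y ->
  polarize (fun v => B v v) x y = B x y.
Proof.
move=> Ksub Bl Br Kx Ky; rewrite /polarize.
have E c : B (x + c *: y) (x + c *: y) =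
    B x x + c * conjc c * B y y + conjc c * B x y + c * B y x.
  have Kc : K (c *: y + x) by exact: Ksub.
  by rewrite [x + _]addrC Bl// !Br//; ring.
rewrite !big_ord_recl big_ord0 /= /bump /= !E expr0 expr1 ?addn0.
have ii : (0 +i* 1 : R[i]) * (0 +i* 1) = -1.
  by apply: complex_eq; rewrite /= ?(mulr0, mul0r, mulr1, add0r, sub0r, addr0, oppr0).
have -> : (0 +i* 1 : R[i]) ^+ (1 + 1)%N = -1 by rewrite expr2 ii.
have -> : (0 +i* 1 : R[i]) ^+ (1 + (1 + 1))%N = - (0 +i* 1).
  by rewrite addnC exprSr expr2 ii mulN1r.
have ci : conjc (0 +i* 1 : R[i]) = - (0 +i* 1).
  by apply: complex_eq; rewrite /= ?oppr0.
have c1 : conjc (-1 : R[i]) = -1 by rewrite rmorphN1.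
have cni : conjc (- (0 +i* 1) : R[i]) = (0 +i* 1) by apply: complex_eq; rewrite /= ?oppr0 ?opprK.
rewrite ci c1 cni (_ : conjc (1 : R[i]) = 1) ?rmorph1//.
set i := (0 +i* 1) in ii *.
have -> : forall a b c d : R[i],
  1 * (a + 1 * 1 * b + 1 * c + 1 * d) +
  (i * (a + i * - i * b + - i * c + i * d) +
  (-1 * (a + -1 * -1 * b + -1 * c + -1 * d) +
   (- i * (a + - i * i * b + i * c + - i * d) + 0))) = 2 * c - 2 * (i * i) * c +
    2 * d + 2 * (i * i) * d.
  by move=> *; ring.
by rewrite ii; field.
Qed.

Section Theory.
Variables (K : set V) (ip : V -> V -> R[i]).
Hypothesis ipP : inner_product K ip.
Let Ksub := ip_sub ipP.
Let K0 := ip_sub0 ipP.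

Lemma ip_subD x y : K x -> K y -> K (x + y).
Proof. by move=> Kx Ky; rewrite -[x]scale1r; exact: Ksub. Qed.

Lemma ip_subZ a x : K x -> K (a *: x).
Proof. by move=> Kx; rewrite -[_ *: _]addr0; exact: Ksub. Qed.

Lemma ip_subB x y : K x -> K y -> K (x - y).
Proof. by move=> Kx Ky; rewrite addrC -scaleN1r; exact: Ksub. Qed.

Lemma ip_sub_sum I (r : seq I) (P : pred I) (F : I -> V) :
  (forall i, K (F i)) -> K (\sum_(i <- r | P i) F i).
Proof. by move=> KF; elim/big_ind : _ => //; exact: ip_subD. Qed.

Lemma ip_linearr a x y z : K x -> K y -> K z ->
  ip z (a *: x + y) = conjc a * ip z x + ip z y.
Proof.
move=> Kx Ky Kz; rewrite (ip_herm ipP (Ksub a Kx Ky) Kz) (ip_linear ipP)//.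
by rewrite rmorphD rmorphM /= -!(ip_herm ipP).
Qed.

Lemma ipDl x y z : K x -> K y -> K z -> ip (x + y) z = ip x z + ip y z.
Proof.
by move=> Kx Ky Kz; rewrite -[x in LHS]scale1r (ip_linear ipP)// mul1r.
Qed.

Lemma ip0l z : K z -> ip 0 z = 0.
Proof.
move=> Kz; have := ip_linear ipP (-1) K0 K0 Kz.
by rewrite scaleN1r oppr0 addr0 mulN1r addNr.
Qed.

Lemma ipZl a x z : K x -> K z -> ip (a *: x) z = a * ip x z.
Proof.
by move=> Kx Kz; rewrite -[a *: x]addr0 (ip_linear ipP)// ip0l// addr0.
Qed.

Lemma ipBl x y z : K x -> K y -> K z -> ip (x - y) z = ip x z - ip y z.
Proof.
by move=> Kx Ky Kz; rewrite addrC -scaleN1r (ip_linear ipP)// mulN1r addrC.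
Qed.

Lemma ip_suml I (r : seq I) (P : pred I) (F : I -> V) z :
  (forall i, K (F i)) -> K z ->
  ip (\sum_(i <- r | P i) F i) z = \sum_(i <- r | P i) ip (F i) z.
Proof.
move=> KF Kz; elim: r => [|i r IH]; first by rewrite !big_nil ip0l.
by rewrite !big_cons; case: (P i) => //; rewrite ipDl// ?IH//; exact: ip_sub_sum.
Qed.

Lemma ip0r z : K z -> ip z 0 = 0.
Proof. by move=> Kz; rewrite (ip_herm ipP K0 Kz) ip0l// conjc0. Qed.

Lemma ipBr x y z : K x -> K y -> K z -> ip z (x - y) = ip z x - ip z y.
Proof.
move=> Kx Ky Kz; rewrite addrC -scaleN1r ip_linearr//.
by rewrite rmorphN1 mulN1r addrC.
Qed.

Lemma ip_real x : K x -> ip x x = (complex.Re (ip x x))%:C.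
Proof.
move=> Kx; have := ip_ge0 ipP Kx; case: (ip x x) => a b.
by rewrite lecE /= => /andP[/eqP ->].
Qed.

Lemma Re_ip_ge0 x : K x -> 0 <= complex.Re (ip x x).
Proof. by move=> Kx; rewrite -ler0c -ip_real//; exact: (ip_ge0 ipP). Qed.

Lemma Re_ip_definite x : K x -> complex.Re (ip x x) = 0 -> x = 0.
Proof. by move=> Kx x0; apply: (ip_definite ipP Kx); rewrite ip_real// x0. Qed.

(** The uniqueness part of the definition of a weak integral. *)
Lemma ip_separate x y : K x -> K y -> (forall z, K z -> ip x z = ip y z) -> x = y.
Proof.
move=> Kx Ky xy; apply/subr0_eq/(ip_definite ipP); first exact: ip_subB.
by rewrite ipBl// ?xy ?subrr//; exact: ip_subB.
Qed.

Lemma ip_CauchySchwarz x y : K x -> K y ->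
  normc (ip x y) ^+ 2 <= complex.Re (ip x x) * complex.Re (ip y y).
Proof.
move=> Kx Ky; have [y0|] := eqVneq (complex.Re (ip y y)) 0.
  by rewrite (Re_ip_definite Ky y0) ip0r// normc0 !ip0l// mulr0 expr0n.
move=> y0; have yy : 0 < complex.Re (ip y y) by rewrite lt_neqAle eq_sym y0 Re_ip_ge0.
pose s := complex.Re (ip y y); pose c := ip x y.
have Ks : K (s%:C *: x - c *: y) by apply: ip_subB; exact: ip_subZ.
have := Re_ip_ge0 Ks.
rewrite ipBl ?ipBr ?ipZl//; try exact: ip_subZ.
have Zr a u v : K u -> K v -> ip v (a *: u) = conjc a * ip v u.
  by move=> Ku Kv; rewrite -[a *: u]addr0 ip_linearr// ip0r// addr0.
rewrite !Zr// (ip_herm ipP Kx Ky) -/c (ip_real Ky) -/s (ip_real Kx) conjc_real.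
set t := complex.Re (ip x x) => h.
have : 0 <= s * (s * t - normc c ^+ 2).
  move: h; congr (0 <= _); rewrite normc_sqr.
  by case: (c) => a b /=; ring.
by rewrite pmulr_rge0// subr_ge0 mulrC.
Qed.

Lemma normc_ip_le x y : K x -> K y ->
  normc (ip x y) <= Num.sqrt (complex.Re (ip x x)) * Num.sqrt (complex.Re (ip y y)).
Proof.
move=> Kx Ky; rewrite -ler_sqr ?nnegrE ?normc_ge0 ?mulr_ge0 ?sqrtr_ge0//.
by rewrite exprMn !sqr_sqrtr ?Re_ip_ge0//; exact: ip_CauchySchwarz.
Qed.

(** Spectral measures are countably additive in norm, while scalar measures need
    additivity against a fixed vector. *)
Lemma ip_cvg0 (u : nat -> V) z : (forall n, K (u n)) -> K z ->
  complex.Re (ip (u n) (u n)) @[n --> \oo] --> (0 : R) ->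
  cvgC \oo (fun n => ip (u n) z) 0.
Proof.
move=> Ku Kz u0; apply: (@cvgC_squeeze _ _ _ _ _ _ (fun n =>
  Num.sqrt (complex.Re (ip (u n) (u n))) * Num.sqrt (complex.Re (ip z z)))).
  by near=> n; rewrite subr0; exact: normc_ip_le.
rewrite -[X in _ --> X](mul0r (Num.sqrt (complex.Re (ip z z)))).
apply: cvgM; last exact: cvg_cst.
rewrite -[X in _ --> X]sqrtr0.
by apply: continuous_cvg => //; exact: sqrt_continuous.
Unshelve. all: by end_near. Qed.

Section Measure.
Context {d : measure_display} {T : measurableType d} (D : set T).
Hypothesis mD : measurable D.
Variable P : set T -> V -> V.
Hypothesis PP : spectral_measure K ip D P.

Let stab := spectral_stable PP.

(** For the constant sequence of empty sets the partial sums are n P(set0) x, which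
    converges only if P(set0) x = 0. *)
Lemma spectral_set0 x : K x -> P set0 x = 0.
Proof.
move=> Kx; have := @spectral_sigma_additive _ _ _ _ _ _ _ _ PP (fun=> set0).
move=> /(_ (fun=> measurable0) (fun=> @sub0set _ _) _ x Kx) /=.
rewrite bigcup0// => /(_ (@trivIset_set0 _ _ _)).
set y := P set0 x.
have Ky : K y by apply: stab.
set c := complex.Re (ip y y) => h.
have c0 : 0 <= c by exact: Re_ip_ge0.
have q n : complex.Re (ip (y - \sum_(k < n) y) (y - \sum_(k < n) y)) =
    (1 - n%:R) ^+ 2 * c.
  rewrite sumr_const card_ord -scaler_nat -{1 3}[y]scale1r -scalerBl.
  have -> : (1 - n%:R : R[i]) = (1 - n%:R)%:C by rewrite rmorphB rmorph1 rmorph_nat.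
  rewrite ipZl//; last exact: ip_subZ.
  rewrite (ip_herm ipP _ Ky)//; last exact: ip_subZ.
  rewrite ipZl// (ip_real Ky) -/c; move: (1 - n%:R) => a /=; ring.
apply: Re_ip_definite => //; apply/eqP; rewrite eq_le c0 andbT -/c.
apply: (ler_cvg_to (cvg_cst c) h); near=> n.
rewrite q ler_peMl// -sqrrN opprB exprn_ege1//.
have n2 : (2 <= n)%N by near: n; exact: nbhs_infty_ge.
by rewrite lerBrDr (ler_nat _ 2 n).
Unshelve. all: by end_near. Qed.

Lemma spectralD A x y : measurable A -> A `<=` D -> K x -> K y ->
  P A (x + y) = P A x + P A y.
Proof.
move=> mA AD Kx Ky.
by have := spectral_linear PP mA AD 1 Kx Ky; rewrite !scale1r.
Qed.

Lemma spectral0 A : measurable A -> A `<=` D -> P A 0 = 0.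
Proof.
move=> mA AD; have := spectralD mA AD K0 K0.
by rewrite addr0 => /eqP; rewrite -subr_eq0 opprD addNKr oppr_eq0 => /eqP.
Qed.

Lemma spectralZ A a x : measurable A -> A `<=` D -> K x ->
  P A (a *: x) = a *: P A x.
Proof.
move=> mA AD Kx; have := spectral_linear PP mA AD a Kx K0.
by rewrite !addr0 spectral0// addr0.
Qed.

Lemma spectralU A B x : measurable A -> measurable B -> A `<=` D -> B `<=` D ->
  A `&` B = set0 -> K x -> P (A `|` B) x = P A x + P B x.
Proof.
move=> mA mB AD BD AB0 Kx.
pose F := bigcup2 A B.
have mF n : measurable (F n).
  by rewrite /F /bigcup2; case: n => [|[|n]] /=.
have FD n : F n `<=` D.
  by rewrite /F /bigcup2; case: n => [|[|n]] /=.
have tF : trivIset setT F by rewrite -trivIset_bigcup2.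
have := spectral_sigma_additive PP mF FD tF Kx; rewrite /= bigcup2E => h.
set y := P (A `|` B) x - (P A x + P B x).
have Ky : K y.
  apply: ip_subB; first by apply: stab => //; [exact: measurableU|rewrite subUset].
  by apply: ip_subD; exact: stab.
suff : y = 0 by move/subr0_eq.
apply: Re_ip_definite => //.
apply: (@cvg_unique _ (@norm_hausdorff _ _) _ _ _ _ _ h).
apply: cvg_near_cst; near=> n.
have n2 : (2 <= n)%N by near: n; exact: nbhs_infty_ge.
rewrite -(subnK n2) addn2 !big_ord_recl /= big1 ?addr0//.
by move=> i _; exact: spectral_set0.
Unshelve. all: by end_near. Qed.

(** As P A + P B = P (A `|` B) is idempotent, P A and P B anticommute; applying P A
    once more shows that they also commute. *)
Lemma spectral_disjoint A B x : measurable A -> measurable B -> A `<=` D ->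
  B `<=` D -> A `&` B = set0 -> K x -> P A (P B x) = 0.
Proof.
move=> mA mB AD BD AB0.
have anti z : K z -> P A (P B z) = - P B (P A z).
  move=> Kz; have mAB := measurableU _ _ mA mB.
  have ABD : A `|` B `<=` D by rewrite subUset.
  have KA := stab mA AD Kz; have KB := stab mB BD Kz.
  have := spectral_idempotent PP mAB ABD Kz.
  rewrite !spectralU// ?spectralD//; try exact: ip_subD.
  rewrite !(spectral_idempotent PP)// => /eqP.
  rewrite -subr_eq0 (_ : _ - _ = P A (P B z) + P B (P A z)); last first.
    set a := P A z; set b := P B z; set u := P A _; set v := P B _.
    rewrite [v + b]addrC addrACA. by rewrite (addrC (a + b)) addrK.
  by rewrite addr_eq0 => /eqP.
move=> Kx; have KA := stab mA AD Kx; have KB := stab mB BD Kx.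
have KAA := stab mA AD KB; have KBA := stab mB BD KA.
have h : P A (P B x) = - P A (P B x).
  rewrite -{1}(spectral_idempotent PP mA AD KB) anti// -scaleN1r spectralZ//.
  by rewrite (anti _ KA) (spectral_idempotent PP)// scalerN scaleN1r.
apply/eqP; have /eqP := h; rewrite -subr_eq0 opprK -mulr2n -scaler_nat.
by rewrite scaler_eq0 pnatr_eq0 /=.
Qed.

Lemma spectralI A B x : measurable A -> measurable B -> A `<=` D ->
  B `<=` D -> K x -> P A (P B x) = P (A `&` B) x.
Proof.
move=> mA mB AD BD Kx.
have mI := measurableI _ _ mA mB.
have mAB := measurableD mA mB; have mBA := measurableD mB mA.
have ID : A `&` B `<=` D by move=> t [/AD].
have ABD : A `\` B `<=` D by move=> t [/AD].
have BAD : B `\` A `<=` D by move=> t [/BD].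
have dA : (A `\` B) `&` (A `&` B) = set0.
  by rewrite setDE setIACA setIid [~` B `&` B]setICl setI0.
have dB : (B `\` A) `&` (A `&` B) = set0.
  by rewrite setDE [A `&` B]setIC setIACA setIid [~` A `&` A]setICl setI0.
have eA : A = (A `\` B) `|` (A `&` B) by rewrite setUC setUIDK.
have eB : B = (B `\` A) `|` (A `&` B) by rewrite setUC setIC setUIDK.
have KI : K (P (A `&` B) x) by exact: stab.
have KBA : K (P (B `\` A) x) by exact: stab.
have -> : P B x = P (B `\` A) x + P (A `&` B) x by rewrite {1}eB spectralU.
have sA z : K z -> P A z = P (A `\` B) z + P (A `&` B) z.
  by move=> Kz; rewrite {1}eA spectralU.
rewrite sA; last exact: ip_subD.
rewrite !spectralD// (spectral_idempotent PP)//.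
rewrite !(@spectral_disjoint _ _ x)// ?add0r ?addr0//.
- by rewrite setIC.
- by rewrite -subset0 => t [[? ?] []].
Qed.

Lemma spectral_bigU (F : nat -> set T) n x : (forall k, measurable (F k)) ->
  (forall k, F k `<=` D) -> trivIset setT F -> K x ->
  P (\big[setU/set0]_(k < n) F k) x = \sum_(k < n) P (F k) x.
Proof.
move=> mF FD tF Kx; elim: n => [|n IH]; first by rewrite !big_ord0 spectral_set0.
rewrite !big_ord_recr /= spectralU// ?IH//.
- exact: bigsetU_measurable.
- by rewrite -bigcup_mkord => t [k _ /FD].
- rewrite -bigcup_mkord -subset0 => t [[k /= kn Fk] Fn].
  have kn' : k = n by apply: tF => //; exists t.
  by rewrite kn' ltnn in kn.
Qed.

Section ScalarMeasure.
Variables (v : V) (Kv : K v).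

(** A measure is nonnegative on all sets, whereas <P(A) v, v> is under control only
    for A measurable. Cutting it off elsewhere does not affect integrals. *)
Definition carrier_measure (A : set T) : \bar R :=
  if pselect (measurable A) then scalar_measure ip D P v A else 0%E.

Let subD A : A `&` D `<=` D. Proof. by move=> t []. Qed.
Let mID A : measurable A -> measurable (A `&` D).
Proof. by move=> mA; exact: measurableI. Qed.

Lemma carrier_measureE A : measurable A ->
  carrier_measure A = scalar_measure ip D P v A.
Proof. by move=> mA; rewrite /carrier_measure; case: pselect. Qed.

Lemma Re_ip_spectral_ge0 A : measurable A -> A `<=` D ->
  0 <= complex.Re (ip (P A v) v).
Proof.
move=> mA AD; rewrite -(spectral_idempotent PP mA AD Kv).
rewrite (spectral_selfadjoint PP)//; last exact: stab.
by apply: Re_ip_ge0; exact: stab.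
Qed.

Lemma ip_spectral_real A : measurable A -> A `<=` D ->
  ip (P A v) v = (complex.Re (ip (P A v) v))%:C.
Proof.
move=> mA AD; rewrite -(spectral_idempotent PP mA AD Kv).
rewrite (spectral_selfadjoint PP)//; last exact: stab.
by apply: ip_real; exact: stab.
Qed.

Let carrier0 : carrier_measure set0 = 0%E.
Proof.
rewrite carrier_measureE// /scalar_measure set0I spectral_set0//.
by rewrite ip0l.
Qed.

Let carrier_ge0 A : (0 <= carrier_measure A)%E.
Proof.
rewrite /carrier_measure; case: pselect => // mA.
by rewrite /scalar_measure lee_fin Re_ip_spectral_ge0//; exact: mID.
Qed.

Let carrier_sigma_additive : semi_sigma_additive carrier_measure.
Proof.
move=> F mF tF mUF.
rewrite carrier_measureE//.
rewrite [X in X @ _ --> _](_ : _ = EFin \o (fun n : nat =>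
    \sum_(0 <= k < n) complex.Re (ip (P (F k `&` D) v) v))); last first.
  apply/funext => n /=; rewrite -sumEFin; apply: eq_bigr => k _.
  by rewrite carrier_measureE.
apply: cvg_EFin; first by near=> n.
rewrite /comp /=.
have tFD : trivIset setT (fun n => F n `&` D).
  by under eq_fun do rewrite setIC; exact: trivIset_setIl.
have Kr n : K (P ((\bigcup_k F k) `&` D) v - \sum_(k < n) P (F k `&` D) v).
  apply: ip_subB; first by apply: stab => //; exact: mID.
  by apply: ip_sub_sum => k; apply: stab => //; exact: mID.
have := spectral_sigma_additive PP (fun n => mID (mF n)) (fun n => @subD (F n)) tFD Kv.
rewrite /= -setI_bigcupl => /(ip_cvg0 Kr Kv) [+ _] /=.
under eq_fun => n.
  rewrite ipBl//; last 2 first.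
    by apply: stab => //; exact: mID.
    by apply: ip_sub_sum => k; apply: stab => //; exact: mID.
  rewrite ip_suml//; last by move=> k; apply: stab => //; exact: mID.
  rewrite ReB Re_sum -opprB.
  over.
move=> /cvgN; rewrite oppr0 => h; apply/subr_cvg0; move: h.
set g := (X in X @ _ --> _ -> _); set h := (X in _ -> X @ _ --> _).
suff -> : g = h by [].
by apply/funext => n; rewrite /g /h /= opprK big_mkord.
Unshelve. all: by end_near. Qed.

Import HBNNSimple.

HB.instance Definition _ := isMeasure.Build d T R carrier_measure
  carrier0 carrier_ge0 carrier_sigma_additive.

Let carrier_fin : fin_num_fun carrier_measure.
Proof. by move=> A mA; rewrite carrier_measureE. Qed.

HB.instance Definition _ :=
  Measure_isFinite.Build d T R carrier_measure carrier_fin.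

Lemma integral_scalar_measure (f : T -> \bar R) :
  integral (scalar_measure ip D P v) D f = integral carrier_measure D f.
Proof.
have E (h : {nnsfun T >-> R}) :
    sintegral (scalar_measure ip D P v) h = sintegral carrier_measure h.
  rewrite /sintegral; apply: eq_fsbigr => x _.
  by rewrite carrier_measureE.
rewrite /integral; congr (ereal_sup _ - ereal_sup _)%E;
  by apply/seteqP; split => _ [h hf <-]; exists h => //; rewrite E.
Qed.

(** The measure <P(.) v, v> is finite, so that a uniform bound on the step functions
    is an integrable dominating function. *)
Lemma complex_integral_step (Phi : T -> R[i]) (I : nat -> finType)
    (c : forall n, I n -> R[i]) (A : forall n, I n -> set T) (M : R) :
  (forall n i, measurable (A n i)) -> (forall n i, A n i `<=` D) ->
  (forall t, D t -> cvgC \oo (fun n => \sum_i c n i * (\1_(A n i) t)%:C) (Phi t)) ->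
  (forall n t, D t -> normc (\sum_i c n i * (\1_(A n i) t)%:C) <= M) ->
  cvgC \oo (fun n => \sum_i c n i * ip (P (A n i) v) v)
    (complex_integral D (scalar_measure ip D P v) Phi).
Proof.
move=> mA AD cPhi bPhi.
have key (g : T -> R) (a : forall n, I n -> R) :
    (forall t, D t -> (\sum_i a n i * \1_(A n i) t) @[n --> \oo] --> g t) ->
    (forall n t, D t -> `|\sum_i a n i * \1_(A n i) t| <= M) ->
    (\sum_i a n i * complex.Re (ip (P (A n i) v) v)) @[n --> \oo] -->
    fine (\int[scalar_measure ip D P v]_(t in D) (g t)%:E)%E.
  move=> ag bg; rewrite integral_scalar_measure.
  pose s n t : \bar R := (\sum_i a n i * \1_(A n i) t)%:E.
  have ms n : measurable_fun D (s n).
    apply/measurable_EFinP; apply: measurable_sum => i.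
    by apply: measurable_funM => //; exact: measurable_indic.
  have muD : (carrier_measure D < +oo)%E by rewrite carrier_measureE// ltry.
  have int_s n : (\int[carrier_measure]_(t in D) s n t =
      (\sum_i a n i * complex.Re (ip (P (A n i) v) v))%:E)%E.
    rewrite /s; under eq_integral do rewrite -sumEFin.
    have int1 i : carrier_measure.-integrable D (fun t => (\1_(A n i) t)%:E).
      by apply: (@integrableS _ _ _ carrier_measure setT) => //; exact: integrable_indic.
    rewrite integral_sum//; last first.
      by move=> i; under eq_fun do rewrite EFinM; exact: integrableZl.
    rewrite -sumEFin; apply: eq_bigr => i _.
    under eq_integral do rewrite EFinM.
    rewrite integralZl// integral_indic//.
    rewrite -[X in (_ * X)%E]/(carrier_measure _) carrier_measureE; last exact: mID.
    rewrite /scalar_measure -setIA setIid EFinM.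
    by congr (_ * (complex.Re (ip (P _ v) v))%:E)%E; exact/setIidl.
  have sg t : D t -> s ^~ t @ \oo --> (EFin \o g) t.
    by move=> Dt; apply: cvg_EFin; [near=> n|exact: ag].
  have mg : measurable_fun D (EFin \o g) by exact: (@emeasurable_fun_cvg _ _ _ _ s).
  have sM n t : D t -> (`|s n t| <= (EFin \o cst M) t)%E.
    by move=> Dt; rewrite lee_fin; exact: bg.
  have [ig _ cv] := @dominated_convergence d T R carrier_measure D mD s
    (EFin \o g) (EFin \o cst M) ms mg (aeW _ sg)
    (@finite_measure_integrable_cst _ _ _ carrier_measure _ _ mD)
    (aeW _ (fun t n => sM n t)).
  move: cv; rewrite (_ : [sequence _]_n = EFin \o (fun n =>
    \sum_i a n i * complex.Re (ip (P (A n i) v) v))); last exact/funext.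
  by rewrite -(fineK (integrable_fin_num mD ig)) => /fine_cvg.
split => /=.
  under eq_fun => n.
    rewrite Re_sum; under eq_bigr => i _ do
      rewrite ip_spectral_real// ReM/= mulr0 subr0.
    over.
  apply: key => [t Dt|n t Dt].
    have [+ _] := cPhi t Dt.
    by under eq_fun => n do
      (rewrite Re_sum; under eq_bigr => i _ do rewrite ReM/= mulr0 subr0).
  apply: le_trans (bPhi n t Dt); apply: le_trans (Re_le_normc _).
  by rewrite Re_sum; under [X in _ <= `|X|]eq_bigr => i _ do
    rewrite ReM/= mulr0 subr0.
under eq_fun => n.
  rewrite Im_sum; under eq_bigr => i _ do
    rewrite ip_spectral_real// ImM/= mulr0 add0r.
  over.
apply: key => [t Dt|n t Dt].
  have [_ +] := cPhi t Dt.
  by under eq_fun => n do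
    (rewrite Im_sum; under eq_bigr => i _ do rewrite ImM/= mulr0 add0r).
apply: le_trans (bPhi n t Dt); apply: le_trans (Im_le_normc _).
by rewrite Im_sum; under [X in _ <= `|X|]eq_bigr => i _ do
  rewrite ImM/= mulr0 add0r.
Unshelve. all: by end_near. Qed.

End ScalarMeasure.

(** To identify an integral with respect to a spectral measure it is enough to
    follow step functions, weakly: dominated convergence for each of the
    measures <P(.) v, v> computes the diagonal of the sesquilinear form defining
    the integral, and polarization the form itself. *)
Lemma spectral_integral_step (Phi : T -> R[i]) (I : nat -> finType)
    (c : forall n, I n -> R[i]) (A : forall n, I n -> set T) (M : R) x z :
  (forall n i, measurable (A n i)) -> (forall n i, A n i `<=` D) ->
  (forall t, D t -> cvgC \oo (fun n => \sum_i c n i * (\1_(A n i) t)%:C) (Phi t)) ->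
  (forall n t, D t -> normc (\sum_i c n i * (\1_(A n i) t)%:C) <= M) ->
  K x -> K z ->
  (forall y, K y ->
    cvgC \oo (fun n => ip (\sum_i c n i *: P (A n i) x) y) (ip z y)) ->
  spectral_integral K ip D P Phi x = z.
Proof.
move=> mA AD cPhi bPhi Kx Kz xz.
have zP y : K y ->
    ip z y = polarize (fun v => complex_integral D (scalar_measure ip D P v) Phi) x y.
  move=> Ky; apply: (cvgC_unique (xz y Ky)).
  have KP n i v : K v -> K (P (A n i) v) by move=> Kv; exact: stab.
  have E n : ip (\sum_i c n i *: P (A n i) x) y =
      polarize (fun v => \sum_i c n i * ip (P (A n i) v) v) x y.
    rewrite (@polarize_sesquilinear K
      (fun v w => \sum_i c n i * ip (P (A n i) v) w))//.
    - rewrite ip_suml//; last by move=> i; apply: ip_subZ; exact: KP.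
      by apply: eq_bigr => i _; rewrite ipZl//; exact: KP.
    - move=> a u v w Ku Kv Kw; rewrite mulr_sumr -big_split /=.
      apply: eq_bigr => i _; rewrite (spectral_linear PP)// (ip_linear ipP)//.
      + by rewrite mulrDr mulrCA.
      + exact: KP.
      + exact: KP.
    - move=> a u v w Ku Kv Kw; rewrite mulr_sumr -big_split /=.
      apply: eq_bigr => i _; rewrite ip_linearr//; last exact: KP.
      by rewrite mulrDr mulrCA.
  rewrite (_ : (fun n => _) = (fun n => polarize
    (fun v => \sum_i c n i * ip (P (A n i) v) v) x y)); last exact/funext.
  apply: cvgCM; apply: cvgC_sum => k; apply: cvgCM.
  apply: (complex_integral_step _ mA AD cPhi bPhi).
  by apply: ip_subD => //; exact: ip_subZ.
rewrite /spectral_integral; case: xgetP => [w _ [Kw wP]|/(_ z) []]; last by split.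
by apply: ip_separate => // y Ky; rewrite wP// zP.
Qed.

End Measure.
End Theory.
End InnerProducts.

(** * Hilbert space geometry, bounded operators and adjoints *)

Section HilbertSpace.
Context {R : realType} {H : completeNormedModType R[i]}.
Implicit Types x y z : H.

(** The norm of H takes its values in R[i]; estimates are made on its real part. *)
Definition nrm x : R := complex.Re `|x|.

Lemma normrE x : `|x| = (nrm x)%:C.
Proof.
rewrite /nrm; have := normr_ge0 x; case: `|x| => a b.
by rewrite lecE /= => /andP[/eqP ->].
Qed.

Lemma nrm_ge0 x : 0 <= nrm x.
Proof. by rewrite -ler0c -normrE. Qed.

Lemma nrm0 : nrm 0 = 0.
Proof. by rewrite /nrm normr0. Qed.

Lemma nrm_eq0 x : nrm x = 0 -> x = 0.
Proof. by move=> x0; apply/eqP; rewrite -normr_eq0 normrE x0. Qed.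

Lemma nrmD x y : nrm (x + y) <= nrm x + nrm y.
Proof. by rewrite -lecR rmorphD /= -!normrE ler_normD. Qed.

Lemma nrmN x : nrm (- x) = nrm x.
Proof. by rewrite /nrm normrN. Qed.

Lemma nrmB x y : nrm (x - y) <= nrm x + nrm y.
Proof. by rewrite -(nrmN y) nrmD. Qed.

Lemma nrm_distrC x y : nrm (x - y) = nrm (y - x).
Proof. by rewrite -nrmN opprB. Qed.

Lemma nrmZ a x : nrm (a *: x) = normc a * nrm x.
Proof. by apply: complexI; rewrite rmorphM /= -!normrE normrZ. Qed.

Lemma nrm_triangle z x y : nrm (x - y) <= nrm (x - z) + nrm (z - y).
Proof.
by rewrite (_ : x - y = (x - z) + (z - y)) ?nrmD// addrA addrNK.
Qed.

Lemma cvg_nrmP {I : Type} (F : set_system I) {FF : Filter F} (u : I -> H) l :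
  u i @[i --> F] --> l <-> nrm (u i - l) @[i --> F] --> (0 : R).
Proof.
split=> [/cvgrPdist_lt ul|/cvgrPdist_lt ul].
  apply/cvgrPdist_lt => e e0; have e0' : 0 < e%:C by rewrite ltcR.
  apply: filterS (ul _ e0') => i.
  by rewrite sub0r normrN ger0_norm ?nrm_ge0// distrC normrE ltcR.
apply/cvgrPdist_lt => e e0.
have [e1 e2] : 0 < complex.Re e /\ e = (complex.Re e)%:C.
  by move: e0; case: e => a b; rewrite ltcE /= => /andP[/eqP -> ->].
apply: filterS (ul _ e1) => i.
by rewrite sub0r normrN ger0_norm ?nrm_ge0// distrC normrE e2 ltcR.
Qed.

Lemma cvg_nrm {I : Type} (F : set_system I) {FF : ProperFilter F} (u : I -> H) l :
  nrm (u i - l) @[i --> F] --> (0 : R) -> nrm (u i) @[i --> F] --> nrm l.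
Proof.
move=> ul; apply: (cvgr_squeeze _ ul); apply: nearW => i.
have h1 : nrm (u i) <= nrm (u i - l) + nrm l.
  by rewrite -{1}[u i](subrK l) nrmD.
have h2 : nrm l <= nrm (u i - l) + nrm (u i).
  by rewrite nrm_distrC -{1}[l](subrK (u i)) nrmD.
by rewrite ler_norml; lra.
Qed.

Lemma nrm_limit_unique (u : nat -> H) x y :
  nrm (u m - x) @[m --> \oo] --> (0 : R) ->
  nrm (u m - y) @[m --> \oo] --> (0 : R) -> x = y.
Proof.
move=> /cvg_nrmP ux /cvg_nrmP uy.
exact: (@cvg_unique _ (@norm_hausdorff _ _) _ _ _ _ ux uy).
Qed.

(** Keeping the rate in the limit turns comparisons between step sums into error
    bounds for the integrals that they approximate. *)
Lemma nrm_complete (u : nat -> H) (b : nat -> R) :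
  (forall n m, nrm (u n - u m) <= b n + b m) -> b @ \oo --> (0 : R) ->
  exists l, forall n, nrm (u n - l) <= b n.
Proof.
move=> ub b0.
have cu : cvg (u @ \oo).
  apply: cauchy_cvg; apply: cauchy_exP => e e0.
  have [e1 e2] : 0 < complex.Re e /\ e = (complex.Re e)%:C.
    by move: e0; case: e => a c; rewrite ltcE /= => /andP[/eqP -> ->].
  have e3 : 0 < complex.Re e / 2 by rewrite divr_gt0.
  have be : \forall n \near \oo, b n < complex.Re e / 2.
    exact: (cvgr_lt 0).
  have [n bn] := filter_ex be; exists (u n).
  apply: filterS be => m bm.
  rewrite -ball_normE /ball_ /= normrE e2 ltcR (le_lt_trans (ub _ _))//.
  by rewrite [ltRHS]splitr ltrD.
exists (lim (u @ \oo)) => n.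
have /cvg_nrmP h := cu; rewrite -[leRHS]addr0.
have h1 : (fun m => b n + b m + nrm (u m - lim (u @ \oo))) @ \oo --> b n + 0 + 0.
  by apply: cvgD => //; apply: cvgD => //; exact: cvg_cst.
rewrite addr0 in h1; apply: (ler_cvg_to (cvg_cst _) h1); near=> m.
by rewrite (le_trans (nrm_triangle (u m) _ _))// lerD2r.
Unshelve. all: by end_near. Qed.

Lemma linear_mapD (T : H -> H) : linear T -> {morph T : x y / x + y}.
Proof. by move=> lT x y; have := lT 1 x y; rewrite !scale1r. Qed.

Lemma linear_mapB (T : H -> H) : linear T -> {morph T : x y / x - y}.
Proof. by move=> lT x y; rewrite addrC -scaleN1r lT scaleN1r addrC. Qed.

Lemma linear_map0 (T : H -> H) : linear T -> T 0 = 0.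
Proof. by move=> lT; rewrite -[in LHS](subrr (0 : H)) linear_mapB// subrr. Qed.

Lemma linear_mapZ (T : H -> H) a x : linear T -> T (a *: x) = a *: T x.
Proof. by move=> lT; have := lT a x 0; rewrite !addr0 linear_map0// addr0. Qed.

Definition bounded_by (c : R) (T : H -> H) := forall x, nrm (T x) <= c * nrm x.

Lemma bounded_byB c d S T : bounded_by c S -> bounded_by d T ->
  bounded_by (c + d) (fun x => S x - T x).
Proof. by move=> Sc Td x; rewrite mulrDl (le_trans (nrmB _ _))// lerD. Qed.

Lemma bounded_byM c d S T : 0 <= c -> bounded_by c S -> bounded_by d T ->
  bounded_by (c * d) (S \o T).
Proof.
by move=> c0 Sc Td x; rewrite -mulrA (le_trans (Sc _))// ler_wpM2l.
Qed.

Lemma bounded_continuous c (T : H -> H) : linear T -> bounded_by c T ->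
  continuous T.
Proof.
move=> lT Tc x; apply/cvg_nrmP.
apply: (@cvgr_squeeze _ _ _ _ _ _ (fun y => c * nrm (y - x))).
  by apply: nearW => y; rewrite subr0 ger0_norm ?nrm_ge0// -linear_mapB.
rewrite -[X in _ --> X](mulr0 c); apply: cvgM; first exact: cvg_cst.
by apply/cvg_nrmP; exact: cvg_id.
Qed.

Variable dot : {dot H for @Num.conj R[i]}.
Hypothesis norm_dot : forall x : H, dot x x = `|x| ^+ 2.

Lemma dotxx x : dot x x = (nrm x ^+ 2)%:C.
Proof. by rewrite norm_dot normrE rmorphXn. Qed.

Lemma Re_dotxx x : complex.Re (dot x x) = nrm x ^+ 2.
Proof. by rewrite dotxx. Qed.

Lemma dotC x y : dot y x = conjc (dot x y).
Proof. by rewrite hermC /= expr0 mul1r. Qed.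

Lemma dotDl x y z : dot (x + y) z = dot x z + dot y z.
Proof. by rewrite linearDl. Qed.

Lemma dotZl a x z : dot (a *: x) z = a * dot x z.
Proof. by rewrite linearZl_LR. Qed.

Lemma dotDr x y z : dot z (x + y) = dot z x + dot z y.
Proof. by rewrite linearDr. Qed.

Lemma dotZr a x z : dot z (a *: x) = conjc a * dot z x.
Proof. by rewrite linearZr_LR. Qed.

Lemma dotNl x z : dot (- x) z = - dot x z.
Proof. by rewrite linearNl. Qed.

Lemma dotNr x z : dot z (- x) = - dot z x.
Proof. by rewrite linearNr. Qed.

Lemma dot0l z : dot 0 z = 0.
Proof. by rewrite linear0l. Qed.

Lemma dot0r z : dot z 0 = 0.
Proof. by rewrite linear0r. Qed.

Lemma dot_suml I (r : seq I) (P : pred I) (F : I -> H) z :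
  dot (\sum_(i <- r | P i) F i) z = \sum_(i <- r | P i) dot (F i) z.
Proof.
by apply: (big_morph (fun x => dot x z)) => [x y|]; rewrite ?dotDl ?dot0l.
Qed.

Lemma dot_sumr I (r : seq I) (P : pred I) (F : I -> H) z :
  dot z (\sum_(i <- r | P i) F i) = \sum_(i <- r | P i) dot z (F i).
Proof.
by apply: (big_morph (dot z)) => [x y|]; rewrite ?dotDr ?dot0r.
Qed.

Lemma dot_inner_product : inner_product [set: H] dot.
Proof.
split=> //.
- by move=> a x y z _ _ _; rewrite dotDl dotZl.
- by move=> x y _ _; exact: dotC.
- move=> x _; rewrite dotxx => -[] /eqP; rewrite sqrf_eq0 => /eqP.
  exact: nrm_eq0.
Qed.

Lemma dot_separate x y : (forall z, dot x z = dot y z) -> x = y.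
Proof. by move=> xy; apply: (ip_separate dot_inner_product) => // z _. Qed.

Lemma normc_dot_le x y : normc (dot x y) <= nrm x * nrm y.
Proof.
have := normc_ip_le dot_inner_product (x := x) (y := y) I I.
by rewrite !Re_dotxx !sqrtr_sqr !ger0_norm ?nrm_ge0.
Qed.

Lemma nrm2D x y : nrm (x + y) ^+ 2 =
  nrm x ^+ 2 + nrm y ^+ 2 + 2 * complex.Re (dot x y).
Proof.
rewrite -!Re_dotxx dotDl !dotDr (dotC x y).
by rewrite !ReD ReJ; ring.
Qed.

(** A relation rather than an operation: the operators below are built from
    projections and unitaries, and their adjoints are built along with them. *)
Definition adjoint (T T' : H -> H) := forall x y, dot (T x) y = dot x (T' y).

Lemma adjointD S S' T T' : adjoint S S' -> adjoint T T' ->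
  adjoint (fun x => S x + T x) (fun x => S' x + T' x).
Proof. by move=> SS TT x y; rewrite dotDl SS TT dotDr. Qed.

Lemma adjointZ a T T' : adjoint T T' ->
  adjoint (fun x => a *: T x) (fun x => conjc a *: T' x).
Proof. by move=> TT x y; rewrite dotZl TT dotZr conjcK. Qed.

Lemma adjointB S S' T T' : adjoint S S' -> adjoint T T' ->
  adjoint (fun x => S x - T x) (fun x => S' x - T' x).
Proof. by move=> SS TT x y; rewrite dotDl dotNl SS TT dotDr dotNr. Qed.

Lemma adjointM S S' T T' : adjoint S S' -> adjoint T T' ->
  adjoint (S \o T) (T' \o S').
Proof. by move=> SS TT x y; rewrite /= SS TT. Qed.

Lemma adjoint_sum (J : finType) (T T' : J -> H -> H) :
  (forall j, adjoint (T j) (T' j)) ->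
  adjoint (fun x => \sum_j T j x) (fun x => \sum_j T' j x).
Proof.
by move=> TT x y; rewrite dot_suml dot_sumr; apply: eq_bigr => j _; exact: TT.
Qed.

Lemma adjoint_linear T T' : adjoint T T' -> linear T.
Proof.
move=> TT a x y; apply: dot_separate => z.
by rewrite TT !dotDl !dotZl !TT.
Qed.

(** |T' x|^2 = <T T' x, x> <= c |T' x| |x|. *)
Lemma adjoint_bounded c T T' : adjoint T T' -> bounded_by c T ->
  bounded_by c T'.
Proof.
move=> TT Tc x; have [->|x0] := eqVneq (nrm (T' x)) 0.
  by rewrite (le_trans (nrm_ge0 _) (Tc x)).
have x1 : 0 < nrm (T' x) by rewrite lt_neqAle eq_sym x0 nrm_ge0.
rewrite -(ler_pM2l x1) -expr2 -Re_dotxx -TT.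
rewrite (le_trans (ler_norm _))// (le_trans (Re_le_normc _))//.
by rewrite (le_trans (normc_dot_le _ _))// mulrCA mulrA ler_wpM2r// nrm_ge0.
Qed.

End HilbertSpace.

(** * Sums over an orthonormal basis *)

Section FiniteSums.
Context {R : realType}.

Lemma esum_le_fset {I : choiceType} (D : set I) (f : I -> R) (M : \bar R) :
  (forall A : {fset I}, [set` A] `<=` D -> ((\sum_(i <- A) f i)%:E <= M)%E) ->
  (\esum_(i in D) (f i)%:E <= M)%E.
Proof.
move=> fM; apply: ge_ereal_sup => _ [A [finA AD] <-].
rewrite fsbig_finite//= sumEFin; apply: fM => i /=.
by rewrite in_fset_set// => /set_mem/AD.
Qed.

Lemma fset_le_esum {I : choiceType} (D : set I) (f : I -> R) (A : {fset I}) :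
  [set` A] `<=` D ->
  ((\sum_(i <- A) f i)%:E <= \esum_(i in D) (f i)%:E)%E.
Proof.
move=> AD; apply: esum_ge; exists [set` A]; first by split.
by rewrite fsbig_finite//= set_fsetK sumEFin.
Qed.

Lemma esum_exchange_le {I J : choiceType} (D : set I) (E : set J)
    (a : I -> J -> \bar R) :
  (forall i j, D i -> E j -> (0 <= a i j)%E) ->
  (\esum_(i in D) \esum_(j in E) a i j <= \esum_(j in E) \esum_(i in D) a i j)%E.
Proof.
move=> a0; apply: ge_ereal_sup => _ [A [finA AD] <-].
rewrite fsbig_finite//= big_seq -esum_sum; last first.
  by move=> j i Ej; rewrite in_fset_set// => /set_mem/AD Di; exact: a0.
apply: le_esum => j Ej; apply: esum_ge; exists A => //.
by rewrite fsbig_finite//= -big_seq.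
Qed.

Lemma esum_exchange {I J : choiceType} (D : set I) (E : set J)
    (a : I -> J -> \bar R) :
  (forall i j, D i -> E j -> (0 <= a i j)%E) ->
  (\esum_(i in D) \esum_(j in E) a i j = \esum_(j in E) \esum_(i in D) a i j)%E.
Proof.
move=> a0; apply/eqP; rewrite eq_le !esum_exchange_le// => j i Ej Di.
exact: a0.
Qed.

Lemma esumZ {I : choiceType} (D : set I) (c : R) (f : I -> R) : 0 <= c ->
  (forall i, D i -> 0 <= f i) ->
  (\esum_(i in D) (c * f i)%:E = c%:E * \esum_(i in D) (f i)%:E)%E.
Proof.
move=> c0 f0.
have le (a : R) (g : I -> R) : 0 <= a -> (forall i, D i -> 0 <= g i) ->
    (\esum_(i in D) (a * g i)%:E <= a%:E * \esum_(i in D) (g i)%:E)%E.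
  move=> a0 g0; apply: esum_le_fset => A AD.
  by rewrite -mulr_sumr EFinM lee_wpmul2l ?lee_fin// fset_le_esum.
apply/eqP; rewrite eq_le le//=.
have [->|cn0] := eqVneq c 0.
  by rewrite mul0e; apply: esum_ge0 => i Di; rewrite mul0r.
have cp : 0 < c by rewrite lt_neqAle eq_sym cn0.
rewrite -lee_pdivlMl//; apply: le_trans (le c^-1 _ _ _); last first.
- by move=> i Di; rewrite mulr_ge0// f0.
- by rewrite invr_ge0.
by apply: le_esum => i Di; rewrite mulKf.
Qed.

End FiniteSums.

Section OrthonormalBasis.
Context {R : realType} {H : completeNormedModType R[i]}.
Variable dot : {dot H for @Num.conj R[i]}.
Hypothesis norm_dot : forall x : H, dot x x = `|x| ^+ 2.
Implicit Types (x y : H) (A : {fset H}).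

Local Notation B := (onb dot).

Lemma onbP : orthonormal_basis dot B.
Proof. exact: svalP. Qed.

Lemma dot_onb e e' : B e -> B e' -> dot e e' = (e == e')%:R.
Proof.
move=> Be Be'; have [[B1 BO] _] := onbP.
by have [<-|ee'] := eqVneq e e'; [exact: B1|exact: BO].
Qed.

(** Orthogonal projection onto the span of finitely many basis vectors. *)
Definition fourier A x := \sum_(e <- A) dot x e *: e.

Lemma dot_fourier A x e : [set` A] `<=` B -> B e ->
  dot (fourier A x) e = if e \in A then dot x e else 0.
Proof.
move=> AB Be; rewrite /fourier dot_suml.
have E (e' : H) : e' \in A -> dot (dot x e' *: e') e = dot x e' * (e' == e)%:R.
  by move=> /AB Be'; rewrite dotZl (dot_onb Be' Be).
rewrite big_seq (eq_bigr _ E) -big_seq; case: ifPn => eA.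
  rewrite (big_fsetD1 e)//= eqxx mulr1 big_seq big1 ?addr0// => e'.
  by rewrite !inE => /andP[/negPf -> _]; rewrite mulr0.
rewrite big_seq big1// => e' e'A; have [ee'|_] := eqVneq e' e; last by rewrite mulr0.
by rewrite -ee' e'A in eA.
Qed.

Lemma fourier_orth A x y : [set` A] `<=` B ->
  dot (x - fourier A x) (fourier A y) = 0.
Proof.
move=> AB; rewrite {2}/fourier dot_sumr big_seq big1// => e eA.
have Be := AB _ eA.
by rewrite dotZr dotDl dotNl dot_fourier// eA subrr mulr0.
Qed.

Lemma nrm2_fourier A x : [set` A] `<=` B ->
  nrm (fourier A x) ^+ 2 = \sum_(e <- A) normc (dot x e) ^+ 2.
Proof.
move=> AB; rewrite -(Re_dotxx norm_dot) {2}/fourier dot_sumr Re_sum.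
rewrite big_seq [RHS]big_seq; apply: eq_bigr => e eA.
by rewrite dotZr dot_fourier ?eA ?normc_sqr 1?mulrC//; exact: AB.
Qed.

Lemma bessel A x : [set` A] `<=` B ->
  nrm x ^+ 2 = nrm (x - fourier A x) ^+ 2 + \sum_(e <- A) normc (dot x e) ^+ 2.
Proof.
move=> AB; rewrite -nrm2_fourier//.
have := nrm2D norm_dot (x - fourier A x) (fourier A x).
by rewrite subrK fourier_orth// mulr0 addr0.
Qed.

(** Completeness of the space turns a maximal orthonormal set into a basis:
    projections whose coefficients nearly exhaust the supremum of the Bessel
    sums form a Cauchy sequence, and its limit has the coefficients of x. *)
Lemma fourier_dense x (eps : R) : 0 < eps ->
  exists2 A : {fset H}, [set` A] `<=` B & nrm (x - fourier A x) <= eps.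
Proof.
move=> eps0.
pose S := sup [set r | exists2 A : {fset H}, [set` A] `<=` B &
  r = \sum_(e <- A) normc (dot x e) ^+ 2].
have hS : has_sup [set r | exists2 A : {fset H}, [set` A] `<=` B &
    r = \sum_(e <- A) normc (dot x e) ^+ 2].
  split; first by exists 0; exists fset0 => //; rewrite big_seq_fset0.
  exists (nrm x ^+ 2) => _ [A AB ->].
  by rewrite (bessel x AB) lerDr sqr_ge0.
have leS A : [set` A] `<=` B -> \sum_(e <- A) normc (dot x e) ^+ 2 <= S.
  by move=> AB; apply: ub_le_sup; [case: hS|exists A].
pose b (n : nat) : R := n.+1%:R^-1.
have b0 n : 0 < b n by rewrite invr_gt0.
have /choice[A AP] n : exists A : {fset H}, [set` A] `<=` B /\
    S - b n ^+ 2 < \sum_(e <- A) normc (dot x e) ^+ 2.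
  have [r [A AB ->] h] := sup_adherent (exprn_gt0 2 (b0 n)) hS.
  by exists A.
have step A1 A2 : [set` A1] `<=` B -> [set` A2] `<=` B -> (A1 `<=` A2)%fset ->
    nrm (fourier A2 x - fourier A1 x) ^+ 2 =
    \sum_(e <- A2) normc (dot x e) ^+ 2 - \sum_(e <- A1) normc (dot x e) ^+ 2.
  move=> A1B A2B A12.
  have e1 := bessel x A1B; rewrite (bessel x A2B) in e1.
  have : nrm (x - fourier A1 x) ^+ 2 = nrm (x - fourier A2 x) ^+ 2 +
      nrm (fourier A2 x - fourier A1 x) ^+ 2.
    have := nrm2D norm_dot (x - fourier A2 x) (fourier A2 x - fourier A1 x).
    rewrite addrA subrK => ->.
    rewrite dotDr dotNr fourier_orth// sub0r.
    rewrite (_ : dot _ (fourier A1 x) = 0) ?oppr0 ?mulr0 ?addr0//.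
    rewrite {2}/fourier dot_sumr big_seq big1// => e eA.
    have Be := A1B _ eA; rewrite dotZr dotDl dotNl dot_fourier//.
    by rewrite (fsubsetP A12 _ eA) subrr mulr0.
  by move: e1; lra.
have uB n C : [set` C] `<=` B -> (A n `<=` C)%fset ->
    nrm (fourier C x - fourier (A n) x) <= b n.
  move=> CB AC; have [AB hA] := AP n.
  rewrite -ler_sqr ?nnegrE ?nrm_ge0 ?(ltW (b0 n))// step//.
  by have := leS _ CB; lra.
have [l lP] : exists l, forall n, nrm (fourier (A n) x - l) <= b n.
  apply: nrm_complete => [n m|]; last exact: cvg_harmonic.
  have CB : [set` (A n `|` A m)%fset] `<=` B.
    by move=> e; rewrite /= inE => /orP[/(proj1 (AP n))|/(proj1 (AP m))].
  rewrite (le_trans (nrm_triangle (fourier (A n `|` A m)%fset x) _ _))//.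
  by rewrite nrm_distrC lerD// uB// ?fsubsetUl ?fsubsetUr.
have xl : x - l = 0.
  have [_] := onbP; apply => e Be.
  apply: eq0_normc; apply/eqP; rewrite eq_le normc_ge0 andbT.
  have h : (fun n => b n + b n) @ \oo --> (0 : R).
    by rewrite -[X in _ --> X]addr0; apply: cvgD; exact: cvg_harmonic.
  apply: (ler_cvg_to (cvg_cst _) h); apply: nearW => n.
  have [AB hA] := AP n.
  rewrite (_ : x - l = (x - fourier (A n) x) + (fourier (A n) x - l)); last first.
    by rewrite addrA subrK.
  rewrite dotDl (le_trans (le_normcD _ _))// lerD//; last first.
    rewrite (le_trans (normc_dot_le norm_dot _ _))//.
    rewrite -[leRHS]mulr1 ler_pM ?nrm_ge0//.
    rewrite -(@ler_sqr R) ?nnegrE ?nrm_ge0// -(Re_dotxx norm_dot) dot_onb// eqxx.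
    by rewrite expr1n.
  rewrite dotDl dotNl dot_fourier//; case: ifPn => eA.
    by rewrite subrr normc0 ltW.
  rewrite subr0 -(@ler_sqr R) ?nnegrE ?normc_ge0 ?(ltW (b0 n))//.
  have CB : [set` (e |` A n)%fset] `<=` B.
    by move=> e'; rewrite /= !inE => /orP[/eqP ->|/AB].
  have := leS _ CB; rewrite big_fsetU1//=; lra.
have bn0 : b @ \oo --> (0 : R) by exact: cvg_harmonic.
have : \forall n \near \oo, b n < eps by exact: (cvgr_lt 0).
move=> /filter_ex[n bn]; exists (A n); first exact: (proj1 (AP n)).
rewrite nrm_distrC (le_trans _ (ltW bn))//.
by have := lP n; rewrite -(subr0_eq xl).
Qed.

Lemma parseval x :
  (\esum_(e in B) (normc (dot x e) ^+ 2)%:E = (nrm x ^+ 2)%:E)%E.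
Proof.
apply/eqP; rewrite eq_le; apply/andP; split.
  apply: esum_le_fset => A AB; rewrite lee_fin.
  by rewrite (bessel x AB) lerDr sqr_ge0.
apply/lee_addgt0Pr => eps eps0.
have [A AB hA] := fourier_dense x (eps := Num.sqrt eps) ltac:(by rewrite sqrtr_gt0).
apply: (@le_trans _ _ ((\sum_(e <- A) normc (dot x e) ^+ 2)%:E + eps%:E)%E).
  rewrite -EFinD lee_fin (bessel x AB) addrC lerD2l.
  by rewrite -(sqr_sqrtr (ltW eps0)) ler_sqr ?nnegrE ?nrm_ge0// sqrtr_ge0.
by rewrite leeD2r// fset_le_esum.
Qed.

End OrthonormalBasis.

(** * Hilbert-Schmidt norms and blocks *)

Section HilbertSchmidtNorm.
Context {R : realType} {H : completeNormedModType R[i]}.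
Variable dot : {dot H for @Num.conj R[i]}.
Hypothesis norm_dot : forall x : H, dot x x = `|x| ^+ 2.
Implicit Types (S T : H -> H).

Local Notation B := (onb dot).

(** The square of the norm, extended-valued so that being Hilbert-Schmidt can be a
    conclusion. *)
Definition hs2 T : \bar R := (\esum_(e in B) (nrm (T e) ^+ 2)%:E)%E.

Definition hs_le T (a : R) := (hs2 T <= (a ^+ 2)%:E)%E.

Lemma hs2_ge0 T : (0 <= hs2 T)%E.
Proof. by apply: esum_ge0 => e _; rewrite lee_fin sqr_ge0. Qed.

Lemma hs_leP T a : hs_le T a <-> forall A : {fset H}, [set` A] `<=` B ->
  \sum_(e <- A) nrm (T e) ^+ 2 <= a ^+ 2.
Proof.
split=> [Ta A AB|Ta]; last by apply: esum_le_fset => A AB; rewrite lee_fin Ta.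
by rewrite -lee_fin; apply: le_trans Ta; exact: (fset_le_esum (fun e => nrm (T e) ^+ 2) AB).
Qed.

Lemma eq_hs2 S T : S =1 T -> hs2 S = hs2 T.
Proof. by move=> ST; apply: eq_esum => e _; rewrite ST. Qed.

Lemma eq_hs_le S T a : S =1 T -> hs_le S a -> hs_le T a.
Proof. by move=> ST; rewrite /hs_le (eq_hs2 ST). Qed.

Lemma hs2_finite T : (hs2 T < +oo)%E ->
  exists2 a, 0 <= a & hs2 T = (a ^+ 2)%:E.
Proof.
move=> Tfin; have : hs2 T \is a fin_num by rewrite ge0_fin_numE// hs2_ge0.
have := hs2_ge0 T; case: (hs2 T) => // r r0 _.
by exists (Num.sqrt r); rewrite ?sqrtr_ge0// sqr_sqrtr// -lee_fin.
Qed.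

(** Both sides are the sum of all |<T e, e'>|^2. *)
Lemma hs2_adjoint T T' : adjoint dot T T' -> hs2 T = hs2 T'.
Proof.
move=> TT; rewrite /hs2.
under eq_esum do rewrite -(parseval norm_dot).
under [RHS]eq_esum do rewrite -(parseval norm_dot).
rewrite esum_exchange; last by move=> e e' _ _; rewrite lee_fin sqr_ge0.
apply: eq_esum => e' _; apply: eq_esum => e _.
by rewrite TT (dotC dot (T' e')) normc_conj.
Qed.

Lemma hs_le_comp_left c S T a : 0 <= c -> bounded_by c S -> hs_le T a ->
  hs_le (S \o T) (c * a).
Proof.
move=> c0 Sc Ta; apply: (@le_trans _ _ ((c ^+ 2)%:E * hs2 T)%E); last first.
  rewrite (_ : ((c * a) ^+ 2)%:E = (c ^+ 2)%:E * (a ^+ 2)%:E)%E.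
    by rewrite lee_wpmul2l// lee_fin sqr_ge0.
  by rewrite -EFinM exprMn.
rewrite /hs2 -esumZ ?sqr_ge0// => [|e _]; last exact: sqr_ge0.
apply: le_esum => e _; rewrite lee_fin -exprMn.
by rewrite ler_sqr ?nnegrE ?nrm_ge0 ?mulr_ge0 ?nrm_ge0//; exact: Sc.
Qed.

(** Right factors are left factors of the adjoint. *)
Lemma hs_le_comp_right c S S' T T' a : 0 <= c -> bounded_by c S ->
  adjoint dot S S' -> adjoint dot T T' -> hs_le T a -> hs_le (T \o S) (c * a).
Proof.
move=> c0 Sc SS TT; rewrite /hs_le (hs2_adjoint TT) (hs2_adjoint (adjointM TT SS)).
by apply: hs_le_comp_left => //; exact: (adjoint_bounded norm_dot SS).
Qed.

Lemma hs2Z (c : R[i]) T :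
  hs2 (fun x => c *: T x) = ((normc c ^+ 2)%:E * hs2 T)%E.
Proof.
rewrite /hs2 -esumZ ?sqr_ge0// => [|e _]; last exact: sqr_ge0.
by apply: eq_esum => e _; rewrite nrmZ exprMn.
Qed.

Lemma hs_leZ c T a : hs_le T a -> hs_le (fun x => c *: T x) (normc c * a).
Proof.
apply: hs_le_comp_left; first exact: normc_ge0.
by move=> x; rewrite nrmZ.
Qed.

Lemma hs_le_mono T a b : 0 <= a -> a <= b -> hs_le T a -> hs_le T b.
Proof.
move=> a0 ab Ta; apply: (le_trans Ta).
by rewrite lee_fin ler_sqr ?nnegrE// (le_trans a0).
Qed.

(** Lower semicontinuity, because a finite partial sum sees only finitely many
    vectors, on which the operators converge. *)
Lemma hs_le_lim (u : nat -> H -> H) T (b : nat -> R) a :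
  (forall x, nrm (u n x - T x) @[n --> \oo] --> (0 : R)) ->
  (\forall n \near \oo, hs_le (u n) (b n)) -> b @ \oo --> a -> hs_le T a.
Proof.
move=> uT ub ba; apply/hs_leP => A AB.
have h1 : (fun n => \sum_(e <- A) nrm (u n e) ^+ 2) @ \oo -->
    \sum_(e <- A) nrm (T e) ^+ 2.
  elim: (A : seq H) => [|e s IH].
    by under eq_fun do rewrite big_nil; rewrite big_nil; exact: cvg_cst.
  under eq_fun do rewrite big_cons; rewrite big_cons; apply: cvgD => //.
  by under eq_fun do rewrite expr2; rewrite expr2; apply: cvgM; exact: cvg_nrm.
have h2 : (fun n => b n ^+ 2) @ \oo --> a ^+ 2.
  by under eq_fun do rewrite expr2; rewrite expr2; exact: cvgM.
by apply: (ler_cvg_to h1 h2); apply: filterS ub => n /hs_leP; exact.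
Qed.

Lemma nrm2D_le (t : R) (x y : H) : 0 < t ->
  nrm (x + y) ^+ 2 <= (1 + t) * nrm x ^+ 2 + (1 + t^-1) * nrm y ^+ 2.
Proof.
move=> t0; apply: (@le_trans _ _ ((nrm x + nrm y) ^+ 2)).
  by rewrite ler_sqr ?nnegrE ?nrm_ge0 ?addr_ge0 ?nrm_ge0// nrmD.
rewrite -subr_ge0.
have -> : (1 + t) * nrm x ^+ 2 + (1 + t^-1) * nrm y ^+ 2 - (nrm x + nrm y) ^+ 2 =
    t^-1 * (t * nrm x - nrm y) ^+ 2 by field; rewrite gt_eqF.
by rewrite mulr_ge0 ?sqr_ge0// invr_ge0 ltW.
Qed.

(** The triangle inequality from a weighted one for squares: the weight t = b / a is
    the optimal one for the bounds a and b, which have to be nonzero for it. *)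
Lemma hs_leD_pos S T a b : 0 < a -> 0 < b -> hs_le S a -> hs_le T b ->
  hs_le (fun x => S x + T x) (a + b).
Proof.
move=> a0 b0 /hs_leP Sa /hs_leP Tb; apply/hs_leP => A AB.
have t0 : 0 < b / a by rewrite divr_gt0.
apply: (@le_trans _ _ (\sum_(e <- A) ((1 + b / a) * nrm (S e) ^+ 2 +
    (1 + (b / a)^-1) * nrm (T e) ^+ 2))).
  by apply: ler_sum => e _; exact: nrm2D_le.
rewrite big_split /= -!mulr_sumr.
have -> : (a + b) ^+ 2 = (1 + b / a) * a ^+ 2 + (1 + (b / a)^-1) * b ^+ 2.
  by field; rewrite !gt_eqF.
have t1 : 0 <= 1 + b / a by rewrite addr_ge0// ltW.
have t2 : 0 <= 1 + (b / a)^-1 by rewrite addr_ge0// invr_ge0 ltW.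
by apply: lerD; apply: ler_wpM2l => //; [exact: Sa|exact: Tb].
Qed.

Lemma hs_leD S T a b : 0 <= a -> 0 <= b -> hs_le S a -> hs_le T b ->
  hs_le (fun x => S x + T x) (a + b).
Proof.
move=> a0 b0 Sa Tb.
(* Bounds that may vanish are approached by positive ones. *)
pose w (n : nat) : R := n.+1%:R^-1.
have w0 n : 0 < w n by rewrite invr_gt0.
apply: (@hs_le_lim (fun=> fun x => S x + T x) _
  (fun n => (a + w n) + (b + w n))).
- by move=> x; under eq_fun do rewrite subrr nrm0; exact: cvg_cst.
- apply: nearW => n; apply: hs_leD_pos; rewrite ?ltr_wpDl//.
    by apply: hs_le_mono Sa => //; rewrite lerDl ltW.
  by apply: hs_le_mono Tb => //; rewrite lerDl ltW.
- rewrite -[X in _ --> X + _]addr0 -[X in _ --> _ + X]addr0.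
  by apply: cvgD; (apply: cvgD; [exact: cvg_cst|exact: cvg_harmonic]).
Qed.

Lemma hs_leB S T a b : 0 <= a -> 0 <= b -> hs_le S a -> hs_le T b ->
  hs_le (fun x => S x - T x) (a + b).
Proof.
move=> a0 b0 Sa Tb; have := hs_leD a0 b0 Sa (b := b) (T := fun x => - T x).
apply; move: Tb; rewrite /hs_le; congr (_ <= _)%E.
by apply: eq_esum => e _; rewrite nrmN.
Qed.

Record resolution {J : finType} (P : J -> H -> H) : Prop := Resolution {
  res_adjoint : forall j, adjoint dot (P j) (P j) ;
  res_orth : forall j k x, P j (P k x) = if j == k then P j x else 0 ;
  res_total : forall x, \sum_j P j x = x }.

Section Resolution.
Context {J : finType} (P : J -> H -> H).
Hypothesis PP : resolution P.

Lemma res_linear j : linear (P j).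
Proof. exact: (adjoint_linear norm_dot (res_adjoint PP j)). Qed.

Lemma resD j x y : P j (x + y) = P j x + P j y.
Proof. exact: (linear_mapD (res_linear j)). Qed.

Lemma res0 j : P j 0 = 0.
Proof. exact: (linear_map0 (res_linear j)). Qed.

Lemma resZ j a x : P j (a *: x) = a *: P j x.
Proof. exact: (linear_mapZ _ _ (res_linear j)). Qed.

Lemma resB j x y : P j (x - y) = P j x - P j y.
Proof. exact: (linear_mapB (res_linear j)). Qed.

Lemma res_sum j {I : finType} (F : I -> H) :
  P j (\sum_i F i) = \sum_i P j (F i).
Proof. exact: (big_morph (P j) (resD j) (res0 j)). Qed.

Lemma res_pick j (y : J -> H) : P j (\sum_k P k (y k)) = P j (y j).
Proof.
rewrite res_sum (bigD1 j)//= res_orth// eqxx big1 ?addr0// => k kj.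
by rewrite res_orth// eq_sym (negPf kj).
Qed.

Lemma res_pythagoras (y : J -> H) :
  nrm (\sum_j P j (y j)) ^+ 2 = \sum_j nrm (P j (y j)) ^+ 2.
Proof.
rewrite -(Re_dotxx norm_dot) {1}dot_suml Re_sum; apply: eq_bigr => j _.
rewrite -[P j (y j)]/(P j (y j)).
have -> : P j (y j) = P j (P j (y j)) by rewrite res_orth// eqxx.
by rewrite (res_adjoint PP) res_pick res_orth// eqxx -(Re_dotxx norm_dot)
  (res_adjoint PP) res_orth// eqxx.
Qed.

Lemma res_nrm2 x : nrm x ^+ 2 = \sum_j nrm (P j x) ^+ 2.
Proof. by rewrite -[in LHS](res_total PP x) res_pythagoras. Qed.

Lemma res_bounded j : bounded_by 1 (P j).
Proof.
move=> x; rewrite mul1r -ler_sqr ?nnegrE ?nrm_ge0// (res_nrm2 x) (bigD1 j)//=.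
by rewrite lerDl sumr_ge0// => k _; exact: sqr_ge0.
Qed.

Lemma hs2_res_left (A : J -> H -> H) :
  hs2 (fun x => \sum_j P j (A j x)) = (\sum_j hs2 (fun x => P j (A j x)))%E.
Proof.
rewrite /hs2 -esum_sum; last by move=> e j _ _; rewrite lee_fin sqr_ge0.
by apply: eq_esum => e _; rewrite res_pythagoras sumEFin.
Qed.

Lemma hs2_res_right (A A' : J -> H -> H) : (forall j, adjoint dot (A j) (A' j)) ->
  hs2 (fun x => \sum_j A j (P j x)) = (\sum_j hs2 (fun x => A j (P j x)))%E.
Proof.
move=> AA.
have adj j : adjoint dot (fun x => A j (P j x)) (fun x => P j (A' j x)).
  exact: (adjointM (AA j) (res_adjoint PP j)).
rewrite (hs2_adjoint (adjoint_sum adj)) hs2_res_left.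
by apply: eq_bigr => j _; rewrite (hs2_adjoint (adj j)).
Qed.

End Resolution.

(** Left blocks are orthogonal vector by vector, and right blocks are left blocks
    of the adjoint. *)
Lemma hs2_blocks {J K : finType} (P : J -> H -> H) (Q : K -> H -> H)
    (A A' : J -> K -> H -> H) :
  resolution P -> resolution Q -> (forall j k, adjoint dot (A j k) (A' j k)) ->
  hs2 (fun x => \sum_j \sum_k P j (A j k (Q k x))) =
  (\sum_j \sum_k hs2 (fun x => P j (A j k (Q k x))))%E.
Proof.
move=> PP QQ AA.
have adj j k : adjoint dot (fun x => P j (A j k x)) (fun x => A' j k (P j x)).
  exact: (adjointM (res_adjoint PP j) (AA j k)).
transitivity (hs2 (fun x => \sum_j P j (\sum_k A j k (Q k x)))).
  by apply: eq_hs2 => x; apply: eq_bigr => j _; rewrite res_sum.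
rewrite (hs2_res_left PP); apply: eq_bigr => j _.
rewrite -(hs2_res_right QQ (adj j)).
by apply: eq_hs2 => x; rewrite res_sum.
Qed.

Lemma hs2_total {J K : finType} (P : J -> H -> H) (Q : K -> H -> H) X X' :
  resolution P -> resolution Q -> adjoint dot X X' ->
  hs2 X = (\sum_j \sum_k hs2 (fun x => P j (X (Q k x))))%E.
Proof.
move=> PP QQ XX; rewrite -(hs2_blocks PP QQ (fun _ _ => XX)).
apply: eq_hs2 => x; have lX := adjoint_linear norm_dot XX.
under eq_bigr do rewrite -(res_sum PP)
  -(big_morph X (linear_mapD lX) (linear_map0 lX)) (res_total QQ).
by rewrite (res_total PP).
Qed.

End HilbertSchmidtNorm.

(** * The Hilbert-Schmidt class as an inner product space *)

Section HilbertSchmidtSpace.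
Context {R : realType} {H : completeNormedModType R[i]}.
Variable dot : {dot H for @Num.conj R[i]}.
Hypothesis norm_dot : forall x : H, dot x x = `|x| ^+ 2.
Implicit Types (X Y Z : H -> H) (A C : {fset H}).

Local Notation B := (onb dot).
Local Notation HS := (hilbert_schmidt dot).

Lemma hs_normE X : hs_norm dot X = sqrte (hs2 dot X).
Proof.
by congr sqrte; apply: eq_esum => e _; rewrite (Re_dotxx norm_dot).
Qed.

Lemma hs_norm_fin X : (hs_norm dot X < +oo)%E = (hs2 dot X < +oo)%E.
Proof.
have := hs2_ge0 dot X; rewrite hs_normE; case: (hs2 dot X) => //= r _.
by rewrite !ltry.
Qed.

Lemma hs_le_norm X a : 0 <= a -> hs_le dot X a <-> (hs_norm dot X <= a%:E)%E.
Proof.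
move=> a0; rewrite hs_normE /hs_le.
have -> : a%:E = sqrte (a ^+ 2)%:E by rewrite /= sqrtr_sqr ger0_norm.
by rewrite lee_sqrt// lee_fin sqr_ge0.
Qed.

Lemma hilbert_schmidt_le X : HS X -> exists2 a, 0 <= a & hs2 dot X = (a ^+ 2)%:E.
Proof. by move=> [_ _]; rewrite hs_norm_fin => /hs2_finite. Qed.

Lemma le_hilbert_schmidt X a : linear X -> continuous X -> hs_le dot X a -> HS X.
Proof.
by move=> lX cX Xa; split => //; rewrite hs_norm_fin (le_lt_trans Xa)// ltry.
Qed.

Lemma hilbert_schmidt_sub a X Y : HS X -> HS Y -> HS (a *: X + Y).
Proof.
move=> hX hY; have [u u0 Xu] := hilbert_schmidt_le hX.
have [v v0 Yv] := hilbert_schmidt_le hY.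
case: hX hY => lX cX _ [lY cY _].
apply: (@le_hilbert_schmidt _ (normc a * u + v)).
- move=> c x y; rewrite !fctE lX lY.
  by rewrite !scalerDr !scalerA mulrC addrACA.
- move=> x; rewrite [X in continuous_at _ X](_ : _ = (fun y => a *: X y + Y y))//.
  apply: cvgD; last exact: cY.
  by apply: cvgZ; [exact: cvg_cst|exact: cX].
- apply: (hs_leD (S := fun x => a *: X x)); rewrite ?mulr_ge0 ?normc_ge0//.
    by apply: hs_leZ; rewrite /hs_le Xu.
  by rewrite /hs_le Yv.
Qed.

Lemma hilbert_schmidt0 : HS 0.
Proof.
have z x : (0 : H -> H) x = 0 by [].
apply: (@le_hilbert_schmidt _ 0).
- by move=> c x y; rewrite !z scaler0 addr0.
- by move=> x; exact: cvg_cst.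
- apply/hs_leP => A AB; rewrite big1 ?sqr_ge0// => e _.
  by rewrite z nrm0 expr0n.
Qed.

(** The inner product of the class polarizes its norm. Along the finite parts of
    the basis it is a limit of sesquilinear sums, and inherits their algebra. *)
Definition finite_parts : set_system {fset H} :=
  filter_from [set A : {fset H} | [set` A] `<=` B]
    (fun A : {fset H} => [set C : {fset H} | (A `<=` C)%fset /\ [set` C] `<=` B]).

Global Instance finite_parts_filter : ProperFilter finite_parts.
Proof.
apply: filter_from_proper => [|A AB]; last by exists A; split.
apply: filter_from_filter; first by exists fset0.
move=> A1 A2 A1B A2B; exists (A1 `|` A2)%fset.
  by move=> e; rewrite /= inE => /orP[/A1B|/A2B].
move=> C [sAC CB]; split; split => //; apply: fsubset_trans sAC.
  exact: fsubsetUl.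
exact: fsubsetUr.
Qed.

Lemma sum_fset_mono A C (f : H -> R) : (forall e, 0 <= f e) -> (A `<=` C)%fset ->
  \sum_(e <- A) f e <= \sum_(e <- C) f e.
Proof.
move=> f0 sAC; rewrite [leRHS](big_fsetID _ (fun e => e \in A))/=.
rewrite (_ : [fset x in C | x \in A]%fset = A) ?lerDl ?sumr_ge0//.
by apply/fsetP => e; rewrite !inE /= andbC; case: (boolP (e \in A)) => // /(fsubsetP sAC).
Qed.

Lemma hs2_cvg X q : hs2 dot X = q%:E ->
  \sum_(e <- A) nrm (X e) ^+ 2 @[A --> finite_parts] --> q.
Proof.
move=> Xq; apply/cvgrPdist_le => eps eps0.
have le A : [set` A] `<=` B -> \sum_(e <- A) nrm (X e) ^+ 2 <= q.
  by move=> AB; rewrite -lee_fin -Xq; exact: (fset_le_esum (fun e => nrm (X e) ^+ 2)).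
have [A AB hA] : exists2 A : {fset H}, [set` A] `<=` B & q - eps <= \sum_(e <- A) nrm (X e) ^+ 2.
  apply: contrapT => nA; have : (hs2 dot X <= (q - eps)%:E)%E.
    apply: esum_le_fset => A AB; rewrite lee_fin leNgt; apply/negP => h.
    by apply: nA; exists A => //; exact: ltW.
  by rewrite Xq lee_fin; lra.
exists A => // C [sAC CB] /=.
have := sum_fset_mono (fun e => sqr_ge0 (nrm (X e))) sAC.
by have := le _ CB; rewrite ler_norml; lra.
Qed.

Lemma hs_dot_cvg X Y : HS X -> HS Y ->
  cvgC finite_parts (fun A => \sum_(e <- A) dot (X e) (Y e)) (hs_dot dot X Y).
Proof.
move=> hX hY.
apply: (@eq_cvgC _ _ _ (fun A =>
    polarize (fun Z : H -> H => (\sum_(e <- A) nrm (Z e) ^+ 2)%:C) X Y)) => [A|].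
  pose F (Z W : H -> H) := \sum_(e <- A) dot (Z e) (W e).
  rewrite -[RHS]/(F X Y) -(@polarize_sesquilinear _ _ [set: H -> H] F)//.
  - rewrite /polarize; congr (_ * _); apply: eq_bigr => k _; congr (_ * _).
    by rewrite /F rmorph_sum; apply: eq_bigr => e _; rewrite dotxx.
  - move=> a U V W _ _ _; rewrite /F mulr_sumr -big_split; apply: eq_bigr => e _.
    by rewrite !fctE dotDl dotZl.
  - move=> a U V W _ _ _; rewrite /F mulr_sumr -big_split; apply: eq_bigr => e _.
    by rewrite !fctE dotDr dotZr.
apply: cvgCM; apply: cvgC_sum => k; apply: cvgCM.
split => /=; last exact: cvg_cst.
have hk : HS (X + (0 +i* 1) ^+ k *: Y) by rewrite addrC; exact: hilbert_schmidt_sub.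
have [a a0 ha] := hilbert_schmidt_le hk.
rewrite (_ : fine _ ^+ 2 = a ^+ 2); first exact: hs2_cvg.
by rewrite hs_normE ha /= sqrtr_sqr ger0_norm.
Qed.

Lemma hs_dotxx X a : HS X -> hs2 dot X = (a ^+ 2)%:E ->
  hs_dot dot X X = (a ^+ 2)%:C.
Proof.
move=> hX Xa; apply: (cvgC_unique (hs_dot_cvg hX hX)).
apply: (@eq_cvgC _ _ _ (fun A => (\sum_(e <- A) nrm (X e) ^+ 2)%:C)).
  by move=> A; rewrite rmorph_sum; apply: eq_bigr => e _; rewrite dotxx.
by split => /=; [exact: hs2_cvg|exact: cvg_cst].
Qed.

Lemma hs_inner_product : inner_product HS (hs_dot dot).
Proof.
split.
- exact: hilbert_schmidt0.
- exact: hilbert_schmidt_sub.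
- move=> a X Y Z hX hY hZ.
  apply: (cvgC_unique (hs_dot_cvg (hilbert_schmidt_sub a hX hY) hZ)).
  apply: eq_cvgC (cvgCD (cvgCM a (hs_dot_cvg hX hZ)) (hs_dot_cvg hY hZ)) => A.
  rewrite mulr_sumr -big_split; apply: eq_bigr => e _.
  by rewrite !fctE dotDl dotZl.
- move=> X Y hX hY; apply: (cvgC_unique (hs_dot_cvg hY hX)).
  apply: eq_cvgC (cvgC_conj (hs_dot_cvg hX hY)) => A.
  rewrite rmorph_sum; apply: eq_bigr => e _.
  by rewrite [RHS]dotC.
- move=> X hX; have [a a0 ha] := hilbert_schmidt_le hX.
  by rewrite (hs_dotxx hX ha) lecR sqr_ge0.
- move=> X hX; have [a a0 ha] := hilbert_schmidt_le hX.
  rewrite (hs_dotxx hX ha) => -[a2].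
  have Xe e : B e -> X e = 0.
    move=> Be; apply: nrm_eq0; apply/eqP; rewrite -sqrf_eq0 eq_le sqr_ge0 andbT.
    have /hs_leP/(_ [fset e]%fset) : hs_le dot X 0.
      by rewrite /hs_le ha a2 expr0n.
    by rewrite big_seq_fset1 expr0n; apply => e'; rewrite /= inE => /eqP ->.
  have [lX cX _] := hX.
  (* Vanishing on the basis, X vanishes on its closed span. *)
  apply/funext => x.
  have /choice[A AP] (n : nat) : exists A : {fset H}, [set` A] `<=` B /\
      nrm (x - fourier dot A x) <= n.+1%:R^-1.
    have [|A AB hA] := fourier_dense norm_dot x (eps := n.+1%:R^-1).
      by rewrite invr_gt0.
    by exists A.
  have cA : (fun n => fourier dot (A n) x) @ \oo --> x.
    apply/cvg_nrmP; apply: (cvgr_squeeze _ cvg_harmonic); apply: nearW => n.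
    by rewrite subr0 ger0_norm ?nrm_ge0// nrm_distrC; exact: (proj2 (AP n)).
  have h : X (fourier dot (A n) x) @[n --> \oo] --> X x.
    by apply: continuous_cvg; [exact: cX|exact: cA].
  have X00 n : X (fourier dot (A n) x) = 0.
    rewrite /fourier (big_morph X (linear_mapD lX) (linear_map0 lX)) big_seq big1//.
    by move=> e /(proj1 (AP n)) Be; rewrite linear_mapZ// Xe// scaler0.
  have {}h : (fun _ : nat => 0 : H) @ \oo --> X x.
    by have := h; under eq_fun do rewrite X00.
  exact: (@cvg_unique _ (@norm_hausdorff _ _) _ _ _ _ h (cvg_cst _)).
Qed.

(** Up to a small norm, Y is concentrated on finitely many basis vectors, where
    pointwise convergence suffices; elsewhere the Z n are only bounded. *)
Lemma hs_dot_weak (Z : nat -> H -> H) (c : R) Y :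
  (forall n, HS (Z n)) -> (forall n, hs_le dot (Z n) c) -> HS Y ->
  (forall e, B e -> nrm (Z n e) @[n --> \oo] --> (0 : R)) ->
  cvgC \oo (fun n => hs_dot dot (Z n) Y) 0.
Proof.
move=> hZ Zc hY Z0; apply: cvgC0_eps => eps3 eps30.
pose eps := eps3 / 3; have eps0 : 0 < eps by rewrite divr_gt0.
have -> : eps3 = 3 * eps by rewrite /eps mulrC divfK.
have [y y0 hy] := hilbert_schmidt_le hY.
(* t balances the two parts of the tail: t * c ^+ 2 and t^-1 * (t * eps) are at
   most eps. *)
pose t := eps / (c ^+ 2 + 1).
have c1 : 0 < c ^+ 2 + 1 by rewrite ltr_wpDl// sqr_ge0.
have t0 : 0 < t by rewrite divr_gt0.
have tc : t * c ^+ 2 <= eps.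
  by rewrite /t mulrAC ler_pdivrMr// ler_pM2l// lerDl.
have te : 0 < t * eps by rewrite mulr_gt0.
have /cvgrPdist_le/(_ _ te) [A AB hA] := hs2_cvg hy.
have sA : (fun n => \sum_(e <- A) nrm (Z n e) * nrm (Y e)) @ \oo --> (0 : R).
  suff : forall s : seq H, (forall e, e \in s -> B e) ->
      (fun n => \sum_(e <- s) nrm (Z n e) * nrm (Y e)) @ \oo --> (0 : R).
    by apply => e /AB.
  elim=> [_|e s + sB].
    by under eq_fun do rewrite big_nil; exact: cvg_cst.
  move=> /(_ (fun e' es => sB e' (@mem_behead _ (e :: s) e' es))) IH.
  under eq_fun do rewrite big_cons.
  have h : nrm (Z n e) * nrm (Y e) @[n --> \oo] --> 0 * nrm (Y e).
    by apply: cvgM; [apply/Z0/sB; exact: mem_head|exact: cvg_cst].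
  rewrite mul0r in h.
  by have hs := cvgD h IH; rewrite addr0 in hs; exact: hs.
have sA' : \forall n \near \oo, \sum_(e <- A) nrm (Z n e) * nrm (Y e) <= eps.
  exact: (cvgr_le 0).
have key n C : (A `<=` C)%fset -> [set` C] `<=` B ->
    normc (\sum_(e <- C) dot (Z n e) (Y e)) <=
    \sum_(e <- A) nrm (Z n e) * nrm (Y e) + (t * c ^+ 2 + t^-1 * (t * eps)).
  move=> sAC CB.
  rewrite (big_fsetID _ (fun e => e \in A))/= (le_trans (le_normcD _ _))//.
  have CA : [fset x in C | x \in A]%fset = A.
    by apply/fsetP => e; rewrite !inE /= andbC; case: (boolP (e \in A)) => // /(fsubsetP sAC).
  rewrite CA; have normc_sum (s : seq H) : normc (\sum_(e <- s) dot (Z n e) (Y e)) <=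
      \sum_(e <- s) nrm (Z n e) * nrm (Y e).
    elim: s => [|e s IH]; first by rewrite !big_nil normc0.
    rewrite !big_cons (le_trans (le_normcD _ _))// lerD//.
    exact: normc_dot_le.
  rewrite lerD// (le_trans (normc_sum _))//.
  set D := [fset x in C | _]%fset.
  have DC : [set` D] `<=` B.
    by move=> e; rewrite /= !inE => /andP[/CB].
  have hZD : \sum_(e <- D) nrm (Z n e) ^+ 2 <= c ^+ 2 by have /hs_leP := Zc n; apply.
  have hYD : \sum_(e <- D) nrm (Y e) ^+ 2 <= t * eps.
    have hC : \sum_(e <- C) nrm (Y e) ^+ 2 <= y ^+ 2.
      have /hs_leP : hs_le dot Y y by rewrite /hs_le hy.
      by apply.
    move: hC; rewrite (big_fsetID _ (fun e => e \in A))/= CA -/D => hC.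
    have /= := hA A (conj (fsubset_refl _) AB).
    by rewrite ler_norml => /andP[_]; lra.
  apply: (@le_trans _ _ (\sum_(e <- D) (t * nrm (Z n e) ^+ 2 + t^-1 * nrm (Y e) ^+ 2))).
    apply: ler_sum => e _; rewrite -subr_ge0.
    have -> : t * nrm (Z n e) ^+ 2 + t^-1 * nrm (Y e) ^+ 2 - nrm (Z n e) * nrm (Y e) =
        t^-1 * (t * nrm (Z n e) - nrm (Y e)) ^+ 2 + nrm (Z n e) * nrm (Y e).
      by field; rewrite gt_eqF.
    have ti : 0 <= t^-1 by rewrite invr_ge0 ltW.
    by apply: addr_ge0; apply: mulr_ge0; rewrite ?sqr_ge0 ?nrm_ge0.
  rewrite big_split /= -!mulr_sumr lerD// ler_wpM2l//; first exact: ltW.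
  by rewrite invr_ge0 ltW.
apply: filterS sA' => n hn.
have h := cvgC_normc (FF := finite_parts_filter) (hs_dot_cvg (hZ n) hY).
apply: (closed_cvg (fun r : R => r <= 3 * eps) _ _ _ h); first exact: closed_le.
exists A => // C [sAC CB] /=.
rewrite (le_trans (key n C sAC CB))// mulKf ?gt_eqF//.
by move: hn tc; lra.
Qed.

End HilbertSchmidtSpace.

(** * A Sylvester equation *)

Section Sylvester.
Context {R : realType} {H : completeNormedModType R[i]}.
Variable dot : {dot H for @Num.conj R[i]}.
Hypothesis norm_dot : forall x : H, dot x x = `|x| ^+ 2.

(** If T were known to be Hilbert-Schmidt, the triangle inequality would give the
    bound at once, since zeta dominates A and C. That T is in the class comes from
    solving the equation by iteration: the iterates stay in a fixed ball of the
    class and converge to T in operator norm. *)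
Lemma sylvester_bound (zeta : R[i]) (A A' C C' T T' : H -> H) (d eta b t : R) :
  adjoint dot A A' -> adjoint dot C C' -> adjoint dot T T' ->
  0 <= d -> bounded_by d A -> bounded_by d C -> 0 <= t -> bounded_by t T ->
  0 < eta -> eta <= normc zeta -> 4 * d <= eta -> 0 <= b ->
  hs_le dot (fun x => zeta *: T x + (A (T x) - T (C x))) b ->
  hs_le dot T (2 * b / eta).
Proof.
move=> AA CC TT d0 Ad Cd t0 Tt eta0 etaz de b0.
set M := (fun x : H => _) => Mb.
pose u n := iter n (fun (S : H -> H) x => zeta^-1 *: (M x - (A (S x) - S (C x))))
  (fun=> 0).
have z0 : normc zeta != 0 by rewrite gt_eqF// (lt_le_trans eta0).
have zn0 : zeta != 0 by apply: contraNneq z0 => ->; rewrite normc0.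
have zi : normc zeta^-1 <= eta^-1.
  by rewrite normcV lef_pV2// posrE (lt_le_trans eta0).
have ei0 : 0 <= eta^-1 by rewrite invr_ge0 ltW.
have lA := adjoint_linear norm_dot AA.
have adjM : adjoint dot M (fun x => conjc zeta *: T' x + (T' (A' x) - C' (T' x))).
  by apply: adjointD; [exact: adjointZ|apply: adjointB;
    [exact: (adjointM AA TT)|exact: (adjointM TT CC)]].
have adju n : exists u', adjoint dot (u n) u'.
  elim: n => [|n [u' IH]]; first by exists (fun=> 0) => x y; rewrite dot0l dot0r.
  eexists; apply: adjointZ; apply: adjointB; first exact: adjM.
  by apply: adjointB; [exact: (adjointM AA IH)|exact: (adjointM IH CC)].
have tau0 : 0 <= 2 * b / eta by rewrite !mulr_ge0.
have hsu n : hs_le dot (u n) (2 * b / eta).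
  elim: n => [|n IH].
    by apply/hs_leP => F FB; rewrite big1 ?sqr_ge0// => e _; rewrite nrm0 expr0n.
  have [u' uu'] := adju n.
  have h : hs_le dot (fun x => M x - (A (u n x) - u n (C x)))
      (b + (d * (2 * b / eta) + d * (2 * b / eta))).
    apply: hs_leB => //; first by rewrite addr_ge0// mulr_ge0.
    apply: hs_leB; rewrite ?mulr_ge0//.
      exact: (hs_le_comp_left d0 Ad IH).
    exact: (hs_le_comp_right norm_dot d0 Cd CC uu' IH).
  have s0 : 0 <= b + (d * (2 * b / eta) + d * (2 * b / eta)).
    by rewrite !addr_ge0// mulr_ge0.
  have := hs_leZ zeta^-1 h; apply: hs_le_mono.
    by rewrite mulr_ge0 ?normc_ge0.
  rewrite [leRHS](_ : 2 * b / eta = eta^-1 * (2 * b)); last by rewrite mulrC.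
  apply: ler_pM => //; first exact: normc_ge0.
  suff : d * (2 * b / eta) <= b / 2 by lra.
  rewrite mulrA ler_pdivrMr// mulrA (_ : d * 2 * b = (4 * d) * (b / 2)); last by field.
  by rewrite mulrC ler_wpM2l// divr_ge0.
have uT n x : nrm (u n x - T x) <= 2^-1 ^+ n * t * nrm x.
  elim: n x => [|n IH] x; first by rewrite /= sub0r nrmN expr0 mul1r Tt.
  have -> : u n.+1 x - T x =
      zeta^-1 *: ((u n (C x) - T (C x)) - A (u n x - T x)).
    rewrite /= -/(u n) (linear_mapB lA) -[T x in LHS](scalerK zn0) -scalerBr; congr (_ *: _).
    rewrite /M addrAC [zeta *: _ + _]addrC addrK !opprB.
    by rewrite addrACA [RHS]addrACA [A (T x) + _]addrC.
  rewrite nrmZ.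
  apply: (@le_trans _ _ (eta^-1 * (2^-1 ^+ n * t * (d * nrm x) +
      d * (2^-1 ^+ n * t * nrm x)))).
    apply: ler_pM => //; [exact: normc_ge0|exact: nrm_ge0|].
    rewrite (le_trans (nrmB _ _))// lerD//.
      rewrite (le_trans (IH _))// ler_wpM2l// mulr_ge0// exprn_ge0//.
    by rewrite (le_trans (Ad _))// ler_wpM2l.
  set s := 2^-1 ^+ n * t * nrm x.
  have s0 : 0 <= s by rewrite !mulr_ge0 ?exprn_ge0 ?nrm_ge0.
  rewrite (_ : _ + _ = 2 * d * s); last by rewrite /s; ring.
  rewrite (_ : 2^-1 ^+ n.+1 * t * nrm x = 2^-1 * s); last by rewrite /s exprS !mulrA.
  rewrite mulrA ler_wpM2r// mulrC ler_pdivrMr//; lra.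
apply: (@hs_le_lim _ _ _ u T (fun=> 2 * b / eta)).
- move=> x; apply: (@cvgr_squeeze _ _ _ _ _ _ (fun n => 2^-1 ^+ n * t * nrm x)).
    by apply: nearW => n; rewrite subr0 ger0_norm ?nrm_ge0.
  rewrite -[X in _ --> X](mul0r (t * nrm x)).
  under eq_fun do rewrite -mulrA.
  apply: cvgM; last exact: cvg_cst.
  by apply: cvg_expr; rewrite ger0_norm// invf_lt1// ltr1n.
- exact: nearW.
- exact: cvg_cst.
Qed.

End Sylvester.

(** * Block estimates near and away from the diagonal *)

Section DiscreteEstimate.
Context {R : realType} {H : completeNormedModType R[i]}.
Variable dot : {dot H for @Num.conj R[i]}.
Hypothesis norm_dot : forall x : H, dot x x = `|x| ^+ 2.

(** The value of the functional calculus of P on the step function c. *)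
Definition step_op {J : finType} (c : J -> R[i]) (P : J -> H -> H) (x : H) : H :=
  \sum_j c j *: P j x.

Section StepOperator.
Context {J : finType} (P : J -> H -> H) (c : J -> R[i]).
Hypothesis PP : resolution dot P.

Lemma step_op_adjoint :
  adjoint dot (step_op c P) (step_op (fun j => conjc (c j)) P).
Proof. by apply: adjoint_sum => j; apply: adjointZ; exact: (res_adjoint PP). Qed.

Lemma res_step_op j x : P j (step_op c P x) = c j *: P j x.
Proof.
rewrite /step_op (res_sum norm_dot PP) (bigD1 j)//= big1 ?addr0 => [|k kj].
  by rewrite (resZ norm_dot PP) (res_orth PP) eqxx.
by rewrite (resZ norm_dot PP) (res_orth PP) eq_sym (negPf kj) scaler0.
Qed.

Lemma step_op_res j x : step_op c P (P j x) = c j *: P j x.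
Proof.
rewrite /step_op (bigD1 j)//= (res_orth PP) eqxx big1 ?addr0// => k kj.
by rewrite (res_orth PP) (negPf kj) scaler0.
Qed.

Lemma nrm2_step_op x : nrm (step_op c P x) ^+ 2 =
  \sum_j normc (c j) ^+ 2 * nrm (P j x) ^+ 2.
Proof.
rewrite (res_nrm2 norm_dot PP); apply: eq_bigr => j _.
by rewrite res_step_op nrmZ exprMn.
Qed.

Lemma step_op_bounded (b : R) : 0 <= b -> (forall j, normc (c j) <= b) ->
  bounded_by b (step_op c P).
Proof.
move=> b0 cb x; rewrite -ler_sqr ?nnegrE ?mulr_ge0 ?nrm_ge0// nrm2_step_op.
rewrite exprMn (res_nrm2 norm_dot PP x) mulr_sumr; apply: ler_sum => j _.
by rewrite ler_wpM2r ?sqr_ge0// ler_sqr ?nnegrE ?normc_ge0.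
Qed.

End StepOperator.

Section Blocks.
Context {J K : finType} (P : J -> H -> H) (Q : K -> H -> H).
Hypotheses (PP : resolution dot P) (QQ : resolution dot Q).

(** By orthogonality of the blocks, a blockwise bound is a global one; in particular
    Schur multipliers are bounded by the supremum of their symbol. *)
Lemma hs_le_blocks (A A' : J -> K -> H -> H) (X X' : H -> H) (c a : R) :
  (forall j k, adjoint dot (A j k) (A' j k)) -> adjoint dot X X' ->
  (forall j k, (hs2 dot (fun x => P j (A j k (Q k x))) <=
    (c ^+ 2)%:E * hs2 dot (fun x => P j (X (Q k x))))%E) ->
  hs_le dot X a ->
  hs_le dot (fun x => \sum_j \sum_k P j (A j k (Q k x))) (c * a).
Proof.
move=> AA XX AX Xa; rewrite /hs_le (hs2_blocks norm_dot PP QQ AA).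
apply: (@le_trans _ _ ((c ^+ 2)%:E * hs2 dot X)%E); last first.
  rewrite (_ : ((c * a) ^+ 2)%:E = (c ^+ 2)%:E * (a ^+ 2)%:E)%E.
    by rewrite lee_wpmul2l// lee_fin sqr_ge0.
  by rewrite -EFinM exprMn.
rewrite (hs2_total norm_dot PP QQ XX) ge0_sume_distrr; last first.
  by move=> j _; apply: sume_ge0 => k _; exact: hs2_ge0.
apply: lee_sum => j _; rewrite ge0_sume_distrr; last by move=> k _; exact: hs2_ge0.
exact: lee_sum.
Qed.

Variables (U V X U' V' X' : H -> H) (z a : J -> R[i]) (w b : K -> R[i]).
Variables (L delta eta : R).
Hypotheses (UU : adjoint dot U U') (VV : adjoint dot V V').
Hypothesis XUV : forall x, X x = U x - V x.
Hypothesis Lip : forall j k, normc (a j - b k) <= L * normc (z j - w k).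
Hypotheses (L0 : 0 <= L) (delta0 : 0 <= delta) (eta0 : 0 < eta).
Hypothesis delta_eta : 4 * delta <= eta.
Hypothesis PU : forall j x, P j (U x) = U (P j x).
Hypothesis QV : forall k x, Q k (V x) = V (Q k x).
Hypothesis Udelta : bounded_by delta (fun x => U x - step_op z P x).
Hypothesis Vdelta : bounded_by delta (fun x => V x - step_op w Q x).

Let XX : adjoint dot X (fun x => U' x - V' x).
Proof.
move=> x y; rewrite XUV; exact: (adjointB UU VV).
Qed.

Definition far j k := eta <= normc (z j - w k).

Definition far_quotient j k : R[i] :=
  if far j k then (a j - b k) / (z j - w k) else 0.

(** The part of f(U) - f(V) carried by the blocks away from the diagonal, for
    the step functions of U and V. *)
Definition far_difference (x : H) : H :=
  \sum_j \sum_k (if far j k then a j - b k else 0) *: P j (Q k x).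

(** The step approximation to the double operator integral. *)
Definition far_integral (x : H) : H :=
  \sum_j \sum_k far_quotient j k *: P j (X (Q k x)).

Lemma far_quotient_le j k : normc (far_quotient j k) <= L.
Proof.
rewrite /far_quotient; case: ifPn => [f|_]; last by rewrite normc0.
have n0 : 0 < normc (z j - w k) by exact: lt_le_trans f.
by rewrite normcM normcV ler_pdivrMr.
Qed.

Lemma far_integral_le s : hs_le dot X s -> hs_le dot far_integral (L * s).
Proof.
move=> Xs.
have AA j k : adjoint dot (fun x => far_quotient j k *: X x) _ := adjointZ _ XX.
apply: (@eq_hs_le _ _ _ (fun x => \sum_j \sum_k P j (far_quotient j k *: X (Q k x)))).
  by move=> x; do 2!apply: eq_bigr => ? _; rewrite (resZ norm_dot PP).
apply: (hs_le_blocks AA XX _ Xs) => j k.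
rewrite (@eq_hs2 _ _ _ _ (fun x => far_quotient j k *: P j (X (Q k x)))).
  rewrite hs2Z lee_wpmul2r ?hs2_ge0// lee_fin.
  by rewrite ler_sqr ?nnegrE ?normc_ge0// far_quotient_le.
by move=> x; rewrite (resZ norm_dot PP).
Qed.

(** With T = P_j Q_k the block of U - V is U T - T V, since P_j commutes with U and
    Q_k with V; replacing U and V by their step functions leaves a scalar. *)
Lemma block_sylvester j k x : P j (X (Q k x)) = (z j - w k) *: P j (Q k x) +
  ((U (P j (Q k x)) - step_op z P (P j (Q k x))) -
   P j (Q k (V x - step_op w Q x))).
Proof.
rewrite XUV (resB norm_dot PP) PU -QV (step_op_res _ PP) (resB norm_dot QQ).
rewrite (res_step_op _ QQ) (resB norm_dot PP) (resZ norm_dot PP) scalerBl.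
set p := z j *: _; set q := w k *: _; set r := U _; set s := P j _.
by rewrite opprB addrACA addKr [p + _]addrC subrK.
Qed.

(** The Sylvester equation bounds P_j Q_k by the block of X, at the cost of a factor
    2 / eta, and the remainder of the equation has size delta. *)
Lemma far_block_le j k s : far j k -> 0 <= s ->
  hs_le dot (fun x => P j (X (Q k x))) s ->
  hs_le dot (fun x => (a j - b k) *: P j (Q k x) -
    far_quotient j k *: P j (X (Q k x))) (L * (4 * delta / eta) * s).
Proof.
move=> jk s0 Xs; have := jk; rewrite /far => etaz.
pose A x := U x - step_op z P x; pose C x := V x - step_op w Q x.
pose T x := P j (Q k x).
have AA : adjoint dot A _ := adjointB UU (step_op_adjoint z PP).
have CC : adjoint dot C _ := adjointB VV (step_op_adjoint w QQ).
have TT : adjoint dot T (fun x => Q k (P j x)).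
  exact: (adjointM (res_adjoint PP j) (res_adjoint QQ k)).
have T1 : bounded_by 1 T.
  rewrite -[1]mulr1; apply: bounded_byM => //; exact: (res_bounded norm_dot).
have Ts : hs_le dot T (2 * s / eta).
  apply: (sylvester_bound norm_dot AA CC TT delta0 Udelta Vdelta _ T1 eta0 etaz) => //.
  by apply: eq_hs_le Xs => x; rewrite block_sylvester.
have t0 : 0 <= 2 * s / eta by rewrite divr_ge0 ?mulr_ge0// ltW.
have h : hs_le dot (fun x => A (T x) - T (C x))
    (delta * (2 * s / eta) + delta * (2 * s / eta)).
  have dt0 : 0 <= delta * (2 * s / eta) by exact: mulr_ge0.
  apply: hs_leB => //.
    exact: (hs_le_comp_left delta0 (Udelta : bounded_by delta A) Ts).
  exact: (hs_le_comp_right norm_dot delta0 (Vdelta : bounded_by delta C) CC TT Ts).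
have := hs_leZ (- far_quotient j k) h.
rewrite (_ : delta * _ + _ = 4 * delta / eta * s); last by field; rewrite gt_eqF.
have e0 : 0 <= 4 * delta / eta * s.
  by rewrite mulr_ge0// divr_ge0 ?mulr_ge0// ltW.
move=> {}h; have {}h : hs_le dot (fun x => - far_quotient j k *: (A (T x) - T (C x)))
    (L * (4 * delta / eta) * s).
  rewrite -mulrA; apply: hs_le_mono h; first by rewrite mulr_ge0// normc_ge0.
  by rewrite ler_wpM2r// normcN far_quotient_le.
apply: eq_hs_le h => x; rewrite block_sylvester [in RHS]scalerDr [in RHS]scalerA.
have -> : far_quotient j k * (z j - w k) = a j - b k.
  rewrite /far_quotient jk divfK//.
  by apply: contraTneq etaz => ->; rewrite normc0 -ltNge.
by rewrite opprD addrA subrr sub0r scaleNr.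
Qed.

Lemma far_difference_le s : 0 <= s -> hs_le dot X s ->
  hs_le dot (fun x => far_difference x - far_integral x)
    (L * (4 * delta / eta) * s).
Proof.
move=> s0 Xs.
pose A j k x := (if far j k then a j - b k else 0) *: x - far_quotient j k *: X x.
have idid : adjoint dot (fun x => x) (fun x => x) by [].
have AA j k : adjoint dot (A j k) _ :=
  adjointB (adjointZ (if far j k then a j - b k else 0) idid)
    (adjointZ (far_quotient j k) XX).
have PA j k x : P j (A j k (Q k x)) =
    (if far j k then a j - b k else 0) *: P j (Q k x) -
    far_quotient j k *: P j (X (Q k x)).
  by rewrite (resB norm_dot PP) !(resZ norm_dot PP).
apply: (@eq_hs_le _ _ _ (fun x => \sum_j \sum_k P j (A j k (Q k x)))).
  move=> x; rewrite -sumrB; apply: eq_bigr => j _; rewrite -sumrB.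
  by apply: eq_bigr => k _; exact: PA.
apply: (hs_le_blocks AA XX _ Xs) => j k.
rewrite (eq_hs2 _ (PA j k)).
have [t t0 ht] : exists2 t, 0 <= t & hs2 dot (fun x => P j (X (Q k x))) = (t ^+ 2)%:E.
  apply: hs2_finite; apply: le_lt_trans (ltry (s ^+ 2)).
  apply: le_trans Xs; rewrite (hs2_total norm_dot PP QQ XX).
  rewrite (bigD1 j)//= (bigD1 k)//= -addeA leeDl// adde_ge0//.
    by apply: sume_ge0 => ? _; exact: hs2_ge0.
  by apply: sume_ge0 => ? _; apply: sume_ge0 => ? _; exact: hs2_ge0.
rewrite ht -EFinM -exprMn; case: (boolP (far j k)) => jk.
  by apply: far_block_le => //; rewrite /hs_le ht.
rewrite /far_quotient (negPf jk).
apply/hs_leP => F FB; rewrite big1 ?sqr_ge0// => e _.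
by rewrite !scale0r subr0 nrm0 expr0n.
Qed.

(** Near the diagonal only the operator norm is under control, and a crude count
    of the blocks is enough. *)
Lemma near_difference_le :
  bounded_by (L * eta * Num.sqrt #|J|%:R)
    (fun x => step_op a P x - step_op b Q x - far_difference x).
Proof.
move=> x; pose c j k := if far j k then 0 else a j - b k.
have cE : step_op a P x - step_op b Q x - far_difference x =
    \sum_j P j (step_op (c j) Q x).
  have -> : step_op a P x = \sum_j \sum_k a j *: P j (Q k x).
    apply: eq_bigr => j _; rewrite -scaler_sumr -(res_sum norm_dot PP).
    by rewrite (res_total QQ).
  have -> : step_op b Q x = \sum_j \sum_k b k *: P j (Q k x).
    rewrite exchange_big; apply: eq_bigr => k _.
    by rewrite -scaler_sumr (res_total PP).
  rewrite -!sumrB; apply: eq_bigr => j _; rewrite -!sumrB (res_sum norm_dot PP).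
  apply: eq_bigr => k _; rewrite (resZ norm_dot PP) -!scalerBl /c.
  by case: ifP; rewrite ?subrr ?subr0.
have Le : 0 <= L * eta by rewrite mulr_ge0// ltW.
rewrite cE -ler_sqr ?nnegrE ?nrm_ge0 ?mulr_ge0 ?sqrtr_ge0 ?nrm_ge0//; last exact: ltW.
rewrite (res_pythagoras norm_dot PP) !exprMn sqr_sqrtr ?ler0n//.
apply: (@le_trans _ _ (\sum_(j : J) (L * eta * nrm x) ^+ 2)); last first.
  by rewrite sumr_const -mulr_natr !exprMn; lra.
apply: ler_sum => j _; rewrite ler_sqr ?nnegrE ?nrm_ge0 ?mulr_ge0 ?nrm_ge0//;
  last exact: ltW.
rewrite (le_trans (res_bounded norm_dot PP _ _))// mul1r.
apply: (step_op_bounded QQ) => // k; rewrite /c /far.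
case: ifPn => [_|]; first by rewrite normc0.
rewrite -ltNge => h; by rewrite (le_trans (Lip j k))// ler_wpM2l// ltW.
Qed.

End Blocks.
End DiscreteEstimate.

(** * Arcs of the circle and the functional calculus *)

Section Arcs.
Context {R : realType}.

Lemma expi_lipschitz_le (s t : R) : s <= t ->
  normc (expi t - expi s) <= 2 * (t - s).
Proof.
move=> st; rewrite (le_trans (normc_le_ReIm _))//.
have lip (f df : R -> R) : (forall x : R, is_derive x 1 f (df x)) ->
    (forall x, `|df x| <= 1) -> `|f t - f s| <= t - s.
  move=> fdf df1.
  have cf : {within `[s, t], continuous f}.
    apply: continuous_subspaceT => x.
    apply/differentiable_continuous/derivable1_diffP.
    by have [] := fdf x.
  have [c _ ->] := MVT_segment st (fun x _ => fdf x) cf.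
  by rewrite normrM -[leRHS]mul1r (ger0_norm (_ : 0 <= t - s)) ?subr_ge0// ler_wpM2r// subr_ge0.
have hc : `|cos t - cos s| <= t - s.
  apply: (lip cos (fun x => - sin x)) => x; last by rewrite normrN sin_max.
have hs : `|sin t - sin s| <= t - s.
  by apply: (lip sin cos) => x; exact: cos_max.
by rewrite /expi /=; move: hc hs; lra.
Qed.

Lemma normc_expi (t : R) : normc (expi t) = 1.
Proof. by rewrite /expi /= cos2Dsin2 sqrtr1. Qed.

(** The scale of the m-th partition of [0, 2 pi] into half-open arcs, the last of
    which is the single point 2 pi. The arcs have a width of order (mesh m)^3, which
    is small against the distance (mesh m)^2 below which blocks count as near,
    while (mesh m)^2 times the square root of the number of arcs still tends to 0.
    The factor 64 makes an arc at most an eighth of that distance wide. *)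
Definition mesh (m : nat) : R := m.+1%:R^-1.
Definition narcs (m : nat) : nat := (64 * m.+1 ^ 3)%N.
Definition width (m : nat) : R := 2 * pi / (narcs m)%:R.
Definition node (m j : nat) : R := j%:R * width m.
Definition arc (m j : nat) : set R :=
  [set t | segment t /\ node m j <= t < node m j.+1].

Lemma mesh_gt0 m : 0 < mesh m.
Proof. by rewrite invr_gt0. Qed.

Lemma mesh_le1 m : mesh m <= 1.
Proof. by rewrite invf_le1// ler1n. Qed.

Lemma cvg_mesh : mesh @ \oo --> (0 : R).
Proof. exact: cvg_harmonic. Qed.

Lemma narcsE m : (narcs m)%:R = 64 / mesh m ^+ 3.
Proof. by rewrite /narcs /mesh natrM natrX exprVn invrK. Qed.

Lemma width_gt0 m : 0 < width m.
Proof.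
by rewrite divr_gt0 ?mulr_gt0 ?pi_gt0// narcsE divr_gt0// exprn_gt0 ?mesh_gt0.
Qed.

Lemma width_le m : width m <= mesh m ^+ 3 / 8.
Proof.
have pi4 : pi <= 4 :> R by have /andP[_] := @pihalf_02 R; lra.
rewrite /width narcsE invf_div mulrA ler_pdivrMr//.
have := exprn_gt0 3 (mesh_gt0 m); nra.
Qed.

Lemma segmentE (t : R) : segment t <-> 0 <= t <= 2 * pi.
Proof. by rewrite /segment /= in_itv. Qed.

Lemma measurable_segment : measurable (@segment R).
Proof. exact: measurable_itv. Qed.

Lemma arc_sub m j : arc m j `<=` segment.
Proof. by move=> t []. Qed.

Lemma measurable_arc m j : measurable (arc m j).
Proof.
rewrite (_ : arc m j = segment `&` `[node m j, node m j.+1[%classic).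
  by apply: measurableI; exact: measurable_itv.
by apply/seteqP; split => t [st]; rewrite /= in_itv.
Qed.

Lemma trivIset_arc m : trivIset setT (arc m).
Proof.
apply/trivIsetP => j k _ _; apply: contra_neqP => /eqP/set0P[t].
move=> [[_ /andP[j1 j2]] [_ /andP[k1 k2]]].
have lt i l : node m i <= t -> t < node m l.+1 -> (i <= l)%N.
  move=> h1 h2; have := le_lt_trans h1 h2.
  by rewrite /node ltr_pM2r ?width_gt0// ltr_nat.
by apply/eqP; rewrite eqn_leq !lt.
Qed.

Lemma arc_exists m (t : R) : segment t -> exists j : 'I_(narcs m).+1, arc m j t.
Proof.
move=> st; have /segmentE/andP[t0 t1] := st.
have w0 := width_gt0 m.
have q0 : 0 <= t / width m by rewrite divr_ge0// ltW.
have /andP[j1 j2] := truncn_itv q0.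
have jn : (Num.truncn (t / width m) < (narcs m).+1)%N.
  rewrite -(ltr_nat R) (le_lt_trans j1)// ltr_pdivrMr// (le_lt_trans t1)//.
  have n0 : (narcs m)%:R != 0 :> R by rewrite pnatr_eq0 /narcs muln_eq0 expn_eq0.
  have -> : 2 * pi = (narcs m)%:R * width m by rewrite /width [RHS]mulrC divfK.
  by rewrite ltr_pM2r// ltr_nat.
exists (Ordinal jn); split => //=.
by rewrite /node -ler_pdivlMr// j1 -ltr_pdivrMr.
Qed.

Lemma cover_arc m : \big[setU/set0]_(j < (narcs m).+1) arc m j = segment.
Proof.
rewrite -bigcup_mkord; apply/seteqP; split; first by move=> t [j _ /arc_sub].
by move=> t /(arc_exists m)[j jt]; exists j => //=.
Qed.

Lemma sum_arc m (c : 'I_(narcs m).+1 -> R[i]) t (j : 'I_(narcs m).+1) : arc m j t ->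
  \sum_(k < (narcs m).+1) c k * (\1_(arc m k) t)%:C = c j.
Proof.
move=> jt; rewrite (bigD1 j)//= indicE mem_set// mulr1 big1 ?addr0// => k kj.
rewrite indicE memNset ?mulr0// => kt.
have kj' : k = j :> nat by apply: (@trivIset_arc m) => //; exists t.
by move: kj; rewrite (val_inj kj') eqxx.
Qed.

Lemma arc_node m j t : arc m j t ->
  normc (expi t - expi (node m j)) <= mesh m ^+ 3 / 4.
Proof.
move=> [_ /andP[j1 j2]]; rewrite (le_trans (expi_lipschitz_le j1))//.
have := width_le m; move: j2; rewrite {1}/node -natr1 mulrDl mul1r -/(node m j); lra.
Qed.

End Arcs.

Section FunctionalCalculus.
Context {R : realType} {H : completeNormedModType R[i]}.
Variable dot : {dot H for @Num.conj R[i]}.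
Hypothesis norm_dot : forall x : H, dot x x = `|x| ^+ 2.
Variable E : set R -> H -> H.
Hypothesis EE : spectral_measure [set: H] dot segment E.

Let dotP := dot_inner_product norm_dot.

Lemma spectral_adjoint A : measurable A -> A `<=` segment ->
  adjoint dot (E A) (E A).
Proof. by move=> mA As x y; exact: (spectral_selfadjoint EE). Qed.

Lemma spectral_commute A B x : measurable A -> measurable B ->
  A `<=` segment -> B `<=` segment -> E A (E B x) = E B (E A x).
Proof.
move=> mA mB As Bs.
by rewrite !(spectralI dotP EE)// setIC.
Qed.

Lemma resolution_arc m :
  resolution dot (fun j : 'I_(narcs m).+1 => E (arc m j)).
Proof.
split=> [j|j k x|x].
- by apply: spectral_adjoint; [exact: measurable_arc|exact: arc_sub].
- have mA := @measurable_arc R m; have sA := @arc_sub R m.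
  case: eqVneq => [<-|jk]; first exact: (spectral_idempotent EE).
  apply: (spectral_disjoint dotP EE) => //.
  by have /trivIsetP/(_ j k I I jk) := @trivIset_arc R m.
- rewrite -(spectral_bigU dotP EE)//.
  + by rewrite cover_arc (spectral_total EE).
  + exact: measurable_arc.
  + exact: arc_sub.
  + exact: trivIset_arc.
Qed.

Section Calculus.
Variables (phi : R -> R[i]) (L M : R).
Hypothesis L0 : 0 <= L.
Hypothesis phi_bounded : forall t, normc (phi t) <= M.
Hypothesis phi_arc : forall m j t, arc m j t ->
  normc (phi t - phi (node m j)) <= L * (mesh m ^+ 3 / 4).

Definition step_calculus m : H -> H :=
  step_op (fun j : 'I_(narcs m).+1 => phi (node m j)) (fun j => E (arc m j)).

(** Two partitions are compared on their common refinement: arcs that do not meet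
    have orthogonal projections, and on arcs that do, both values are close to that
    of phi at a common point. *)
Lemma step_calculus_cauchy m n x :
  nrm (step_calculus m x - step_calculus n x) <=
  L * (mesh m ^+ 3 / 4) * nrm x + L * (mesh n ^+ 3 / 4) * nrm x.
Proof.
set b := L * (mesh m ^+ 3 / 4) + L * (mesh n ^+ 3 / 4).
have b0 : 0 <= b.
  by rewrite addr_ge0// mulr_ge0// divr_ge0// exprn_ge0// ltW// mesh_gt0.
pose P (j : 'I_(narcs m).+1) := E (arc m j).
pose Q (k : 'I_(narcs n).+1) := E (arc n k).
have PP : resolution dot P := resolution_arc m.
have QQ : resolution dot Q := resolution_arc n.
have PQ j k y : P j (Q k y) = Q k (P j y).
  by apply: spectral_commute; [exact: measurable_arc|exact: measurable_arc|
    exact: arc_sub|exact: arc_sub].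
pose c (j : 'I_(narcs m).+1) (k : 'I_(narcs n).+1) : R[i] :=
  if pselect (arc m j `&` arc n k = (set0 : set R)) then 0 else phi (node m j) - phi (node n k).
have cb j k : normc (c j k) <= b.
  rewrite /c; case: pselect => [h|] /=; first by rewrite expr0n addr0 sqrtr0.
  move/eqP/set0P => [t [jt kt]].
  rewrite (_ : _ - _ = (phi t - phi (node n k)) - (phi t - phi (node m j))).
    by rewrite (le_trans (le_normcD _ _))// normcN addrC lerD// phi_arc.
  by rewrite opprB [RHS]addrC addrA subrK.
have PQ0 (j : 'I_(narcs m).+1) (k : 'I_(narcs n).+1) (y : H) : (arc m j `&` arc n k = (set0 : set R)) -> P j (Q k y) = 0.
  move=> jk; apply: (spectral_disjoint dotP EE) => //;
    [exact: measurable_arc|exact: measurable_arc|exact: arc_sub|exact: arc_sub].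
rewrite -mulrDl -/b.
have -> : step_calculus m x - step_calculus n x =
    \sum_j P j (step_op (c j) Q (P j x)).
  have -> : step_calculus m x =
      \sum_(j < (narcs m).+1) \sum_(k < (narcs n).+1) phi (node m j) *: P j (Q k x).
    apply: eq_bigr => j _; rewrite -scaler_sumr -(res_sum norm_dot PP).
    by rewrite (res_total QQ).
  have -> : step_calculus n x =
      \sum_(j < (narcs m).+1) \sum_(k < (narcs n).+1) phi (node n k) *: P j (Q k x).
    rewrite exchange_big; apply: eq_bigr => k _.
    by rewrite -scaler_sumr (res_total PP).
  rewrite -sumrB; apply: eq_bigr => j _; rewrite -sumrB (res_sum norm_dot PP).
  apply: eq_bigr => k _; rewrite (resZ norm_dot PP) -PQ (res_orth PP) eqxx.
  rewrite -scalerBl /c; case: pselect => //= jk.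
  by rewrite PQ0// !scaler0.
rewrite -ler_sqr ?nnegrE ?nrm_ge0 ?mulr_ge0 ?nrm_ge0//.
rewrite (res_pythagoras norm_dot PP) exprMn (res_nrm2 norm_dot PP x) mulr_sumr.
apply: ler_sum => j _; rewrite -exprMn.
rewrite ler_sqr ?nnegrE ?nrm_ge0 ?mulr_ge0 ?nrm_ge0//.
rewrite (le_trans (res_bounded norm_dot PP _ _))// mul1r.
exact: (step_op_bounded norm_dot QQ).
Qed.

Let T := operator_integral dot E phi.

Lemma cvg_rate (a : R) : (fun m => L * (mesh m ^+ 3 / 4) * a) @ \oo --> (0 : R).
Proof.
have h : (fun m => (L / 4 * a) * (mesh m * (mesh m * mesh m))) @ \oo -->
    (L / 4 * a) * (0 * (0 * 0)).
  apply: cvgM; first exact: cvg_cst.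
  by apply: cvgM; [exact: cvg_mesh|apply: cvgM; exact: cvg_mesh].
rewrite !mulr0 in h.
suff -> : (fun m => L * (mesh m ^+ 3 / 4) * a) =
  (fun m => (L / 4 * a) * (mesh m * (mesh m * mesh m))) by [].
by apply/funext => m; ring.
Qed.

(** The step functions of the spectral measure converge to the integral in
    operator norm, at the rate of the modulus of continuity. *)
Lemma step_calculus_approx m x :
  nrm (step_calculus m x - T x) <= L * (mesh m ^+ 3 / 4) * nrm x.
Proof.
have [z zP] : exists z, forall n,
    nrm (step_calculus n x - z) <= L * (mesh n ^+ 3 / 4) * nrm x.
  apply: nrm_complete; last exact: cvg_rate.
  by move=> n k; exact: step_calculus_cauchy.
suff -> : T x = z by exact: zP.
apply: (spectral_integral_step dotP measurable_segment EE (M := M)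
  (I := fun n => 'I_(narcs n).+1) (c := fun n j => phi (node n j))
  (A := fun n j => arc n j)) => //.
- by move=> n j; exact: measurable_arc.
- by move=> n j; exact: arc_sub.
- move=> t st; apply: (cvgC_squeeze (b := fun n => L * (mesh n ^+ 3 / 4) * 1));
    last exact: cvg_rate.
  apply: nearW => n; have [j jt] := arc_exists n st.
  by rewrite (sum_arc _ jt) normcB_sym mulr1 phi_arc.
- by move=> n t /(arc_exists n)[j jt]; rewrite (sum_arc _ jt).
- move=> y _; apply: (cvgC_squeeze
    (b := fun n => L * (mesh n ^+ 3 / 4) * (nrm x * nrm y))); last exact: cvg_rate.
  apply: nearW => n; rewrite -[X in normc (X - _)]/(dot (step_calculus n x) y).
  rewrite -dotNl -dotDl (le_trans (normc_dot_le norm_dot _ _))// mulrA.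
  by rewrite ler_wpM2r ?nrm_ge0.
Qed.

Lemma step_calculus_cvg x : nrm (step_calculus m x - T x) @[m --> \oo] --> (0 : R).
Proof.
apply: (cvgr_squeeze _ (cvg_rate (nrm x))); apply: nearW => m.
by rewrite subr0 ger0_norm ?nrm_ge0// step_calculus_approx.
Qed.

Lemma operator_integral_linear : linear T.
Proof.
move=> a x y.
apply: (nrm_limit_unique (step_calculus_cvg (a *: x + y))).
have lS m := adjoint_linear norm_dot
  (step_op_adjoint (fun j : 'I_(narcs m).+1 => phi (node m j)) (resolution_arc m)).
apply: (@cvgr_squeeze _ _ _ _ _ _ (fun m =>
  L * (mesh m ^+ 3 / 4) * (normc a * nrm x) + L * (mesh m ^+ 3 / 4) * nrm y)).
  apply: nearW => m; rewrite subr0 ger0_norm ?nrm_ge0// /step_calculus lS.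
  rewrite (_ : _ - _ = a *: (step_calculus m x - T x) + (step_calculus m y - T y)).
    rewrite (le_trans (nrmD _ _))// lerD ?step_calculus_approx// nrmZ.
    by rewrite mulrCA ler_wpM2l ?normc_ge0// step_calculus_approx.
  by rewrite scalerBr opprD addrACA.
by rewrite -[X in _ --> X]addr0; apply: cvgD; exact: cvg_rate.
Qed.

Lemma operator_integral_commute A x : measurable A -> A `<=` segment ->
  E A (T x) = T (E A x).
Proof.
move=> mA As; have EA := spectral_adjoint mA As.
have lE := adjoint_linear norm_dot EA.
have Eb : bounded_by 1 (E A).
  move=> y; rewrite mul1r; have [->|Ey0] := eqVneq (nrm (E A y)) 0.
    exact: nrm_ge0.
  have Ey : 0 < nrm (E A y) by rewrite lt_neqAle eq_sym Ey0 nrm_ge0.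
  rewrite -(ler_pM2l Ey) -expr2 -(Re_dotxx norm_dot) -EA (spectral_idempotent EE)//.
  rewrite (le_trans (ler_norm _))// (le_trans (Re_le_normc _))//.
  exact: normc_dot_le.
apply: (nrm_limit_unique (u := fun m => step_calculus m (E A x))); last first.
  exact: step_calculus_cvg.
have SE m : step_calculus m (E A x) = E A (step_calculus m x).
  rewrite /step_calculus /step_op (big_morph (E A) (linear_mapD lE) (linear_map0 lE)).
  apply: eq_bigr => j _; rewrite linear_mapZ// spectral_commute//.
    exact: measurable_arc.
  exact: arc_sub.
apply: (cvgr_squeeze _ (cvg_rate (nrm x))); apply: nearW => m.
rewrite subr0 ger0_norm ?nrm_ge0// SE -linear_mapB// (le_trans (Eb _))// mul1r.
exact: step_calculus_approx.
Qed.

Lemma operator_integral_bounded : exists c, bounded_by c T.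
Proof.
exists (M + L * (mesh 0 ^+ 3 / 4)) => x.
rewrite -[T x](subrK (step_calculus 0 x)) mulrDl addrC (le_trans (nrmD _ _))//.
rewrite lerD//; last by rewrite nrm_distrC step_calculus_approx.
apply: (step_op_bounded norm_dot (resolution_arc 0)) => //.
exact: le_trans (normc_ge0 _) (phi_bounded 0).
Qed.

End Calculus.
End FunctionalCalculus.

(** * Lipschitz functions of two unitaries *)

Section Lipschitz.
Context {R : realType}.
Variable f : R[i] -> R[i].
Hypothesis lipf : lipschitz_circle f.

Let quotient (z w : R[i]) : R := normc (f z - f w) / normc (z - w).

Lemma lip_norm_ub z w : `|z| = 1 -> `|w| = 1 -> z != w ->
  ((quotient z w)%:E <= lip_norm f)%E.
Proof.
move=> z1 w1 zw; apply: ereal_sup_ubound; exists z, w; split => //.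
by rewrite !normr_normc -fmorphV -rmorphM.
Qed.

Lemma lip_normE : exists2 L, 0 <= L & lip_norm f = L%:E.
Proof.
have h : ((quotient 1 (-1))%:E <= lip_norm f)%E.
  apply: lip_norm_ub; rewrite ?normr1 ?normrN1//.
  by rewrite -subr_eq0 opprK -mulr2n pnatr_eq0.
have q0 : 0 <= quotient 1 (-1) by rewrite divr_ge0 ?normc_ge0.
have := lipf; rewrite /lipschitz_circle; move: h; case: (lip_norm f) => [L| |]//.
by rewrite lee_fin => /(le_trans q0) L0 _; exists L.
Qed.

Lemma lip_normP L : lip_norm f = L%:E -> forall s t : R,
  normc (f (expi s) - f (expi t)) <= L * normc (expi s - expi t).
Proof.
move=> fL s t; have [->|st] := eqVneq (expi s) (expi t).
  by rewrite !subrr normc0 mulr0.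
have st0 : 0 < normc (expi s - expi t).
  rewrite lt_neqAle normc_ge0 andbT eq_sym; apply: contra st => /eqP/eq0_normc.
  by move/subr0_eq ->.
have := @lip_norm_ub (expi s) (expi t).
rewrite !normr_normc !normc_expi => /(_ erefl erefl st).
by rewrite fL lee_fin /quotient ler_pdivrMr.
Qed.

End Lipschitz.

Section Perturbation.
Context {R : realType} {H : completeNormedModType R[i]}.
Variable dot : {dot H for @Num.conj R[i]}.
Hypothesis norm_dot : forall x : H, dot x x = `|x| ^+ 2.
Variables (U V : H -> H) (E F : set R -> H -> H).
Hypotheses (unitaryU : unitary dot U) (unitaryV : unitary dot V).
Hypotheses (EU : spectral_measure_of dot U E) (FV : spectral_measure_of dot V F).
Hypothesis UV : hilbert_schmidt dot (U - V).
Variables (f : R[i] -> R[i]) (L : R).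
Hypothesis L0 : 0 <= L.
Hypothesis fL : forall s t : R,
  normc (f (expi s) - f (expi t)) <= L * normc (expi s - expi t).

Lemma unitary_adjoint (S : H -> H) : unitary dot S -> exists S', adjoint dot S S'.
Proof.
move=> [_ Sdot /choice[S' SS']]; exists S' => x y.
by rewrite -{1}(SS' y) Sdot.
Qed.

Lemma f_expi_bounded (t : R) : normc (f (expi t)) <= L * 2 + normc (f (expi 0)).
Proof.
rewrite -[f (expi t)](subrK (f (expi 0))) (le_trans (le_normcD _ _))// lerD2r.
rewrite (le_trans (fL _ _))// ler_wpM2l// (le_trans (le_normcD _ _))//.
by rewrite normcN !normc_expi.
Qed.

Lemma f_expi_arc m j (t : R) : arc m j t ->
  normc (f (expi t) - f (expi (node m j))) <= L * (mesh m ^+ 3 / 4).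
Proof. by move=> jt; rewrite (le_trans (fL _ _))// ler_wpM2l// arc_node. Qed.

Lemma expi_bounded (t : R) : normc (expi t) <= 1.
Proof. by rewrite normc_expi. Qed.

Lemma expi_arc m j (t : R) : arc m j t ->
  normc (expi t - expi (node m j)) <= 1 * (mesh m ^+ 3 / 4).
Proof. by rewrite mul1r; exact: arc_node. Qed.

Local Notation fU := (functional_calculus dot f E).
Local Notation fV := (functional_calculus dot f F).
Local Notation X := (U - V).
Local Notation W := (fU - fV).
Let z m (j : 'I_(narcs m).+1) : R[i] := expi (node m j).
Let a m (j : 'I_(narcs m).+1) : R[i] := f (expi (node m j)).
Let P m (j : 'I_(narcs m).+1) := E (arc m j).
Let Q m (j : 'I_(narcs m).+1) := F (arc m j).
Arguments z : clear implicits.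
Arguments a : clear implicits.
Arguments P : clear implicits.
Arguments Q : clear implicits.
Let EE := EU.1.
Let FF := FV.1.
Let PP m : resolution dot (P m) := resolution_arc norm_dot EE m.
Let QQ m : resolution dot (Q m) := resolution_arc norm_dot FF m.
Let delta (m : nat) : R := mesh m ^+ 3 / 4.
Let eta (m : nat) : R := mesh m ^+ 2.

Let D' m := far_difference (P m) (Q m) (z m) (a m) (z m) (a m) (eta m).
Let D m := far_integral (P m) (Q m) X (z m) (a m) (z m) (a m) (eta m).

Let m0 m : 0 < mesh m :> R. Proof. exact: mesh_gt0. Qed.
Let delta0 m : 0 <= delta m. Proof. by rewrite divr_ge0// exprn_ge0// ltW. Qed.
Let eta0 m : 0 < eta m. Proof. by rewrite exprn_gt0. Qed.

Let delta_eta m : 4 * delta m <= eta m.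
Proof.
rewrite /delta /eta mulrC divfK// exprS ler_piMl ?mesh_le1//.
by rewrite exprn_ge0// ltW.
Qed.

Let Lip m j k : normc (a m j - a m k) <= L * normc (z m j - z m k).
Proof. exact: fL. Qed.

Let commute_nodes m j x : P m j (U x) = U (P m j x).
Proof.
rewrite {1 2}EU.2; apply: (operator_integral_commute norm_dot EE ler01 expi_bounded);
  [exact: expi_arc|exact: measurable_arc|exact: arc_sub].
Qed.

Let commute_nodesV m j x : Q m j (V x) = V (Q m j x).
Proof.
rewrite {1 2}FV.2; apply: (operator_integral_commute norm_dot FF ler01 expi_bounded);
  [exact: expi_arc|exact: measurable_arc|exact: arc_sub].
Qed.

Let Udelta m : bounded_by (delta m) (fun x => U x - step_op (z m) (P m) x).
Proof.
move=> x; rewrite nrm_distrC {1}EU.2 -[delta m]mul1r.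
exact: (step_calculus_approx norm_dot EE ler01 expi_bounded expi_arc).
Qed.

Let Vdelta m : bounded_by (delta m) (fun x => V x - step_op (z m) (Q m) x).
Proof.
move=> x; rewrite nrm_distrC {1}FV.2 -[delta m]mul1r.
exact: (step_calculus_approx norm_dot FF ler01 expi_bounded expi_arc).
Qed.

Let XE x : X x = U x - V x. Proof. by []. Qed.
Let WE x : W x = fU x - fV x. Proof. by []. Qed.

(** Convergence in operator norm of the off-diagonal parts of the step
    approximations to f(U) - f(V). *)
Let rate m : R := 2 * (L * delta m) + L * eta m * Num.sqrt (narcs m).+1%:R.

Lemma far_difference_approx m x : nrm (D' m x - W x) <= rate m * nrm x.
Proof.
have hU := step_calculus_approx norm_dot EE L0 f_expi_bounded f_expi_arc m x.
have hV := step_calculus_approx norm_dot FF L0 f_expi_bounded f_expi_arc m x.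
have := near_difference_le norm_dot (PP m) (QQ m) (@Lip m) L0 (eta0 m) x.
rewrite card_ord -/(D' m x) => hN.
rewrite (_ : D' m x - W x =
  (step_op (a m) (P m) x - fU x) - (step_op (a m) (Q m) x - fV x) -
  (step_op (a m) (P m) x - step_op (a m) (Q m) x - D' m x)); last first.
  have id (s t u v d : H) : d - (u - v) = (s - u) - (t - v) - (s - t - d).
    rewrite (_ : s - u - _ = (s - t) - (u - v)); last first.
      by rewrite !opprD !opprK addrACA.
    by set w := u - v; set q := s - t; rewrite (opprB q d) [RHS]addrC addrA subrK.
  exact: id.
rewrite /rate mulrDl (le_trans (nrmB _ _))// lerD// (le_trans (nrmB _ _))//.
move: hU hV; rewrite -/(delta m) /step_calculus -/(a m); lra.
Qed.

Lemma cvg_rate0 : rate @ \oo --> (0 : R).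
Proof.
have h1 : (fun m => 2 * L * mesh m) @ \oo --> 2 * L * (0 : R).
  by apply: cvgM; [exact: cvg_cst|exact: cvg_mesh].
have h2 : (fun m => L * Num.sqrt (65 * mesh m)) @ \oo --> L * Num.sqrt (65 * (0 : R)).
  apply: cvgM; first exact: cvg_cst.
  apply: continuous_cvg; first exact: sqrt_continuous.
  by apply: cvgM; [exact: cvg_cst|exact: cvg_mesh].
have h : (fun m => 2 * L * mesh m + L * Num.sqrt (65 * mesh m)) @ \oo -->
    2 * L * (0 : R) + L * Num.sqrt (65 * (0 : R)) by exact: cvgD.
rewrite !mulr0 sqrtr0 mulr0 addr0 in h.
apply: (cvgr_squeeze _ h); apply: nearW => m.
have m1 := @mesh_le1 R m; have mm := m0 m.
have r0 : 0 <= rate m.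
  by rewrite addr_ge0 ?mulr_ge0 ?sqrtr_ge0// ltW.
have dm : delta m <= mesh m.
  rewrite /delta; have : mesh m ^+ 3 <= mesh m :> R; last by lra.
  by rewrite exprS ler_piMr ?exprn_ile1// ltW.
rewrite subr0 ger0_norm// /rate lerD//.
  by rewrite mulrA ler_wpM2l// mulr_ge0.
rewrite -mulrA ler_wpM2l//.
have -> : eta m * Num.sqrt (narcs m).+1%:R = Num.sqrt (eta m ^+ 2 * (narcs m).+1%:R).
  by rewrite sqrtrM ?sqr_ge0// sqrtr_sqr ger0_norm// ltW.
apply: ler_wsqrtr; rewrite -natr1 narcsE mulrDr mulr1.
have -> : eta m ^+ 2 * (64 / mesh m ^+ 3) = 64 * mesh m.
  by rewrite /eta; field; rewrite gt_eqF.
have : eta m ^+ 2 <= mesh m; last by lra.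
by rewrite /eta -exprM exprS ler_piMr ?exprn_ile1// ltW.
Qed.

Lemma far_difference_cvg x : nrm (D' m x - W x) @[m --> \oo] --> (0 : R).
Proof.
have h : (fun m => rate m * nrm x) @ \oo --> 0 * nrm x.
  by apply: cvgM; [exact: cvg_rate0|exact: cvg_cst].
rewrite mul0r in h; apply: (cvgr_squeeze _ h); apply: nearW => m.
by rewrite subr0 ger0_norm ?nrm_ge0// far_difference_approx.
Qed.

Let ratio m : 4 * delta m / eta m = mesh m.
Proof. by rewrite /delta /eta; field; rewrite gt_eqF. Qed.

Lemma far_difference_integral_le m s : 0 <= s -> hs_le dot X s ->
  hs_le dot (fun x => D' m x - D m x) (L * mesh m * s).
Proof.
move=> s0 Xs; rewrite -ratio.
have [U' UU] := unitary_adjoint unitaryU; have [V' VV] := unitary_adjoint unitaryV.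
exact: (far_difference_le norm_dot (PP m) (QQ m) UU VV XE (@Lip m) L0 (delta0 m)
  (eta0 m) (delta_eta m) (@commute_nodes m) (@commute_nodesV m) (Udelta m) (Vdelta m) s0 Xs).
Qed.

Lemma far_integral_bound m s : hs_le dot X s -> hs_le dot (D m) (L * s).
Proof.
have [U' UU] := unitary_adjoint unitaryU; have [V' VV] := unitary_adjoint unitaryV.
exact: (far_integral_le norm_dot (PP m) (QQ m) UU VV XE (@Lip m) L0 (eta0 m)).
Qed.

(** The far parts converge to f(U) - f(V) in operator norm, and their
    Hilbert-Schmidt norms exceed L s by at most L s (mesh m). *)
Lemma difference_hs_le s : 0 <= s -> hs_le dot X s -> hs_le dot W (L * s).
Proof.
move=> s0 Xs.
apply: (@hs_le_lim _ _ _ D' W (fun m => L * s + L * mesh m * s)).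
- exact: far_difference_cvg.
- apply: nearW => m.
  have := hs_leD _ _ (far_integral_bound m Xs) (far_difference_integral_le m s0 Xs).
  rewrite !mulr_ge0// ?ltW// => /(_ isT isT); apply: eq_hs_le => x.
  by rewrite addrC subrK.
- have h : (fun m => L * s + L * mesh m * s) @ \oo --> L * s + L * 0 * s.
    apply: cvgD; first exact: cvg_cst.
    apply: cvgM; last exact: cvg_cst.
    by apply: cvgM; [exact: cvg_cst|exact: cvg_mesh].
  by rewrite mulr0 mul0r addr0 in h.
Qed.

Lemma difference_linear : linear W.
Proof.
have lU := operator_integral_linear norm_dot EE L0 f_expi_bounded f_expi_arc.
have lV := operator_integral_linear norm_dot FF L0 f_expi_bounded f_expi_arc.
move=> c x y; rewrite !WE /functional_calculus lU lV scalerBr.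
by rewrite opprD addrACA.
Qed.

Lemma difference_continuous : continuous W.
Proof.
have [c cU] := operator_integral_bounded norm_dot EE L0 f_expi_bounded f_expi_arc.
have [d dV] := operator_integral_bounded norm_dot FF L0 f_expi_bounded f_expi_arc.
exact: (bounded_continuous difference_linear (bounded_byB cU dV)).
Qed.

Lemma difference_hilbert_schmidt : hilbert_schmidt dot W.
Proof.
have [s s0 Xs] := hilbert_schmidt_le norm_dot UV.
apply: (le_hilbert_schmidt norm_dot (a := L * s)).
- exact: difference_linear.
- exact: difference_continuous.
- by apply: difference_hs_le => //; rewrite /hs_le Xs.
Qed.

Section Integral.
Variable G : set (R * R) -> (H -> H) -> (H -> H).
Hypothesis GG : double_spectral_measure dot E F G.

Let hsP := hs_inner_product norm_dot.
Let I_ m := ('I_(narcs m).+1 * 'I_(narcs m).+1)%type.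
Let q m (i : I_ m) : R[i] := far_quotient (z m) (a m) (z m) (a m) (eta m) i.1 i.2.
Let block m (i : I_ m) : set (R * R) := arc m i.1 `*` arc m i.2.
Arguments q : clear implicits.
Arguments block : clear implicits.

Lemma far_integralE m : D m = \sum_i q m i *: G (block m i) X.
Proof.
apply/funext => x; rewrite fct_sumE /D /far_integral pair_bigA /=.
apply: eq_bigr => -[j k] _ /=.
by rewrite /block /= GG.2//; [exact: measurable_arc|exact: arc_sub|
  exact: measurable_arc|exact: arc_sub].
Qed.

Let sum_block m t (i : I_ m) : block m i t ->
  \sum_k q m k * (\1_(block m k) t)%:C = q m i.
Proof.
move=> it; rewrite (bigD1 i)//= indicE mem_set// mulr1 big1 ?addr0// => k ki.
rewrite indicE memNset ?mulr0// => kt; case/negP: ki.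
have tr := @trivIset_arc R m.
rewrite -pair_eqE /= /pair_eq /=; apply/andP.
split; apply/eqP/val_inj; apply: tr => //.
  by exists t.1; split; [exact: kt.1|exact: it.1].
by exists t.2; split; [exact: kt.2|exact: it.2].
Qed.

(** Over the diagonal all blocks are near, hence dropped, in agreement with the
    value 0 of the quotient there; any other point is eventually in a far block. *)
Let cvg_quotient t : (segment `*` segment) t ->
  cvgC \oo (fun m => \sum_i q m i * (\1_(block m i) t)%:C)
    (difference_quotient f t).
Proof.
case: t => s t [/= ss st].
have Q_near m : exists2 i : I_ m, block m i (s, t) &
    normc (expi s - z m i.1) <= delta m /\ normc (expi t - z m i.2) <= delta m.
  have [j js] := arc_exists m ss; have [k kt] := arc_exists m st.
  by exists (j, k) => //=; split; exact: arc_node.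
rewrite /difference_quotient /=; case: eqVneq => [est|nst].
  apply: (cvgC_squeeze (b := fun=> 0)); last exact: cvg_cst.
  apply: nearW => m; have [i ib [h1 h2]] := Q_near m.
  rewrite (sum_block ib) subr0 /q /far_quotient ifN ?normc0//.
  rewrite /far -ltNge (_ : z m i.1 - z m i.2 =
    (expi t - z m i.2) - (expi s - z m i.1)); last first.
    by rewrite est opprB [RHS]addrC addrA subrK.
  rewrite (le_lt_trans (le_normcD _ _))// normcN.
  have := delta_eta m; have := eta0 m; lra.
set r := normc (expi s - expi t).
have r0 : 0 < r.
  rewrite lt_neqAle normc_ge0 andbT eq_sym; apply: contra nst => /eqP/eq0_normc.
  by move/subr0_eq ->.
apply: (cvgC_squeeze (b := fun m => L * (mesh m ^+ 3 / 4) * (4 / r)));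
  last exact: cvg_rate.
have near_r : \forall m \near \oo, 2 * mesh m < r.
  have h : (fun m => 2 * mesh m) @ \oo --> 2 * (0 : R).
    by apply: cvgM; [exact: cvg_cst|exact: cvg_mesh].
  by rewrite mulr0 in h; exact: (cvgr_lt 0).
apply: filterS near_r => m mr; have [i ib [h1 h2]] := Q_near m.
rewrite (sum_block ib).
have zE : z m i.1 - z m i.2 =
    (expi s - expi t) - ((expi s - z m i.1) - (expi t - z m i.2)).
  by ring.
have zr : r <= normc (z m i.1 - z m i.2) + 2 * delta m.
  rewrite /r (_ : expi s - expi t = (z m i.1 - z m i.2) +
    ((expi s - z m i.1) - (expi t - z m i.2))); last by ring.
  rewrite (le_trans (le_normcD _ _))// lerD2l (le_trans (le_normcD _ _))// normcN.
  by move: h1 h2; lra.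
have m1 := @mesh_le1 R m; have mm := m0 m.
have jk : far (z m) (z m) (eta m) i.1 i.2.
  have e1 : eta m <= mesh m by rewrite /eta exprS ler_piMr// ?expr1// ltW.
  have d1 : 4 * delta m <= mesh m by exact: le_trans (delta_eta m) e1.
  by rewrite /far; move: zr mr e1 d1; lra.
have zeta0 : z m i.1 - z m i.2 != 0.
  by apply: contraTneq jk => h; rewrite /far h normc0 -ltNge.
have xi0 : expi s - expi t != 0 by rewrite subr_eq0.
rewrite /q /far_quotient jk.
rewrite (_ : _ - _ = ((a m i.1 - f (expi s)) - (a m i.2 - f (expi t))) / (expi s - expi t) +
    (a m i.1 - a m i.2) / (z m i.1 - z m i.2) *
    (((expi s - z m i.1) - (expi t - z m i.2)) / (expi s - expi t))); last first.
  by field; rewrite xi0 zeta0.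
have hs := fL (node m i.1) s; have ht := fL (node m i.2) t.
rewrite normcB_sym in h1; rewrite normcB_sym in h2.
have hs' : normc (a m i.1 - f (expi s)) <= L * delta m.
  by rewrite (le_trans hs)// ler_wpM2l.
have ht' : normc (a m i.2 - f (expi t)) <= L * delta m.
  by rewrite (le_trans ht)// ler_wpM2l.
have ri : 0 <= r^-1 by rewrite invr_ge0 ltW.
rewrite (le_trans (le_normcD _ _))//.
have -> : L * (mesh m ^+ 3 / 4) * (4 / r) =
    (L * delta m + L * delta m) / r + L * ((delta m + delta m) / r).
  by rewrite /delta; field; rewrite gt_eqF.
rewrite lerD//.
  rewrite normcM normcV ler_wpM2r// (le_trans (le_normcD _ _))// normcN lerD//.
rewrite normcM ler_pM ?normc_ge0//.
  have n0 : 0 < normc (z m i.1 - z m i.2) by exact: lt_le_trans (eta0 m) jk.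
  by rewrite normcM normcV ler_pdivrMr// Lip.
rewrite normcM normcV ler_wpM2r// (le_trans (le_normcD _ _))// normcN.
by rewrite normcB_sym lerD// normcB_sym.
Qed.

(** The step integrals converge weakly to f(U) - f(V): they are bounded in the
    class, they differ from the far parts by an error tending to 0 in the class, and
    the far parts converge in operator norm. *)
Lemma difference_double_integral :
  double_operator_integral dot G (difference_quotient f) X = W.
Proof.
have mS : measurable (segment `*` segment : set (R * R)).
  by apply: measurableX; exact: measurable_segment.
have [s s0 hXs] := hilbert_schmidt_le norm_dot UV.
have Xs : hs_le dot X s by rewrite /hs_le hXs.
have mB m i : measurable (block m i) by apply: measurableX; exact: measurable_arc.
have sB m i : block m i `<=` segment `*` segment.
  by move=> t [h1 h2]; split; [exact: (arc_sub h1)|exact: (arc_sub h2)].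
apply: (spectral_integral_step hsP mS GG.1 mB sB cvg_quotient (M := L)) => //.
- move=> m t [t1 t2]; have [j jt] := arc_exists m t1; have [k kt] := arc_exists m t2.
  by rewrite (@sum_block m t (j, k))// /q far_quotient_le//; exact: Lip.
- exact: difference_hilbert_schmidt.
move=> Y hY.
have hW := difference_hilbert_schmidt.
have hD m : hilbert_schmidt dot (D m).
  rewrite far_integralE; apply: (ip_sub_sum hsP) => i; apply: (ip_subZ hsP).
  exact: (spectral_stable GG.1).
have hDW m : hilbert_schmidt dot (D m - W) by exact: (ip_subB hsP).
have weak : cvgC \oo (fun m => hs_dot dot (D m - W) Y) 0.
  apply: (hs_dot_weak norm_dot (c := L * s + L * s)) => //.
    move=> m; have Ls : 0 <= L * s by exact: mulr_ge0.
    exact: (hs_leB Ls Ls (far_integral_bound m Xs) (difference_hs_le s0 Xs)).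
  move=> e Be.
  have h : (fun m => L * mesh m * s + nrm (D' m e - W e)) @ \oo --> L * 0 * s + 0.
    apply: cvgD; last exact: far_difference_cvg.
    apply: cvgM; last exact: cvg_cst.
    by apply: cvgM; [exact: cvg_cst|exact: cvg_mesh].
  rewrite mulr0 mul0r addr0 in h.
  apply: (cvgr_squeeze _ h); apply: nearW => m.
  rewrite subr0 ger0_norm ?nrm_ge0//.
  have id (u v w : H) : u - w = (v - w) - (v - u).
    by rewrite opprB [RHS]addrC addrA subrK.
  rewrite (_ : (D m - W) e = (D' m e - W e) - (D' m e - D m e)); last exact: id.
  rewrite (le_trans (nrmB _ _))// addrC lerD2r.
  have /hs_leP := far_difference_integral_le m s0 Xs.
  move=> /(_ [fset e]%fset); rewrite big_seq_fset1 ler_sqr ?nnegrE ?nrm_ge0//.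
    by apply => e'; rewrite /= inE => /eqP ->.
  by rewrite !mulr_ge0// ltW.
have h : cvgC \oo (fun m => hs_dot dot (D m - W) Y + hs_dot dot W Y) (0 + hs_dot dot W Y).
  by apply: cvgCD => //; exact: cvgC_cst.
rewrite add0r in h; apply: eq_cvgC h => m.
by rewrite (ipBl hsP)// subrK far_integralE.
Qed.

End Integral.
End Perturbation.

Theorem theorem4p1 (R : realType) (H : completeNormedModType R[i])
    (dot : {dot H for @Num.conj R[i]})
    (norm_dot : forall x : H, dot x x = `|x| ^+ 2)
    (U V : H -> H) (E F : set R -> H -> H)
    (unitaryU : unitary dot U) (unitaryV : unitary dot V)
    (EU : spectral_measure_of dot U E) (FV : spectral_measure_of dot V F)
    (UV : hilbert_schmidt dot (U - V))
    (f : R[i] -> R[i]) (lipf : lipschitz_circle f) :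
  (forall G : set (R * R) -> (H -> H) -> (H -> H),
    double_spectral_measure dot E F G ->
    functional_calculus dot f E - functional_calculus dot f F =
    double_operator_integral dot G (difference_quotient f) (U - V)) /\
  (hs_norm dot (functional_calculus dot f E - functional_calculus dot f F)%R
     <= lip_norm f * hs_norm dot (U - V)%R)%E.
Proof.
have [L L0 fL] := lip_normE lipf.
have Lf := lip_normP fL.
split=> [G GG|].
  by rewrite (difference_double_integral norm_dot unitaryU unitaryV EU FV UV L0 Lf GG).
have [s s0 Xs] := hilbert_schmidt_le norm_dot UV.
have nX : hs_norm dot (U - V) = s%:E.
  by rewrite (hs_normE norm_dot) Xs /= sqrtr_sqr ger0_norm.
rewrite fL nX -EFinM; apply/(hs_le_norm norm_dot); first exact: mulr_ge0.
apply: (difference_hs_le norm_dot unitaryU unitaryV EU FV L0 Lf) => //.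
by rewrite /hs_le Xs.
Qed.
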